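(* Let $d\ge1$ and $n\ge d+2$. Then $L_{d,n}$ is an algebraic variety in $\mathbb C^N$ of pure dimension $dn-\binom{d+1}{2}$. If moreover $d\ge 2$, then $L_{d,n}$ is irreducible.
   Context: Let $N=\binom{n}{2}$ and index coordinates of $\mathbb C^N$ by pairs $\{i,j\}$, $1\le i<j\le n$. For a complex configuration ${\bf p}=({\bf p}_1,\dots,{\bf p}_n)$ in $\mathbb C^d$, $m({\bf p})\in\mathbb C^N$ has coordinates $m_{ij}({\bf p})=\sum_{k=1}^d({\bf p}_i^k-{\bf p}_j^k)^2$ (no conjugation). $M_{d,n}$ is the image of $m$ over all complex configurations. With $s:\mathbb C^N\to\mathbb C^N$ the map squaring each coordinate, $L_{d,n}=s^{-1}(M_{d,n})$. *)

(* Defs.v *)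
(* Complex numbers are modelled as R[i] = complex R for an
   arbitrary R : realType (complete archimedean ordered field, i.e. the reals). *)
From mathcomp Require Import all_boot all_algebra.
From mathcomp Require Import reals complex.
From mathcomp Require mpoly.

Set Implicit Arguments.
Unset Strict Implicit.
Unset Printing Implicit Defensive.

Import GRing.Theory.
Local Open Scope ring_scope.

Section Zariski.
Variables (K : fieldType) (I : finType).

Definition pt := I -> K.
Definition ptset := pt -> Prop.

Definition peval (p : mpoly.mpoly #|I| K) (x : pt) : K :=
  mpoly.meval (fun k : 'I_#|I| => x (enum_val k)) p.

Definition zariski_closed (X : ptset) : Prop :=
  exists S : mpoly.mpoly #|I| K -> Prop,
    forall x, X x <-> (forall p, S p -> peval p x = 0).

Definition subset (X Y : ptset) : Prop := forall x, X x -> Y x.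
Definition psubset (X Y : ptset) : Prop := subset X Y /\ exists x, Y x /\ ~ X x.

Definition irreducible (X : ptset) : Prop :=
  [/\ zariski_closed X, (exists x, X x) &
      forall Y Z : ptset, zariski_closed Y -> zariski_closed Z ->
        (forall x, X x -> Y x \/ Z x) -> subset X Y \/ subset X Z].

Definition irreducible_component (X Z : ptset) : Prop :=
  [/\ irreducible Z, subset Z X &
      forall W, irreducible W -> subset Z W -> subset W X -> subset W Z].

Definition irr_chain (X : ptset) (k : nat) (Z : nat -> ptset) : Prop :=
  [/\ forall i, (i <= k)%N -> irreducible (Z i),
      forall i, (i <= k)%N -> subset (Z i) X &
      forall i, (i < k)%N -> psubset (Z i) (Z i.+1)].

Definition alg_dim (X : ptset) (k : nat) : Prop :=
  (exists Z, irr_chain X k Z) /\ ~ (exists Z, irr_chain X k.+1 Z).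

Definition variety_pure_dim (X : ptset) (k : nat) : Prop :=
  [/\ zariski_closed X, (exists x, X x) &
      forall Z, irreducible_component X Z -> alg_dim Z k].

End Zariski.

(* unordered pairs {i,j}, 1 <= i < j <= n, represented as i < j in 'I_n;
   #|pairs n| = 'C(n,2) = N *)
Definition pairs (n : nat) : finType :=
  {p : 'I_n * 'I_n | (p.1 < p.2)%N}.

Section Measurement.
Variables (C : fieldType) (d n : nat).

Definition config := 'I_n -> 'I_d -> C.

(* m(p)_{ij} = sum_k (p_i^k - p_j^k)^2  (no conjugation) *)
Definition msq (p : config) : pt C (pairs n) :=
  fun ij => \sum_(k < d) ((p (val ij).1 k - p (val ij).2 k) ^+ 2).

Definition Mdn : ptset C (pairs n) := fun x => exists p : config, msq p = x.

Definition sq (x : pt C (pairs n)) : pt C (pairs n) := fun ij => x ij ^+ 2.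

Definition Ldn : ptset C (pairs n) := fun x => Mdn (sq x).

End Measurement.

Arguments Ldn : clear implicits.
Arguments Mdn : clear implicits.

(* Main.v *)
(* Over an algebraically closed field of characteristic 0, let s be the squaring map
   and G the group of sign changes of coordinates, so that the fibres of s are the
   orbits of G.  The map s is closed, and by Zorn's lemma every irreducible subset of
   M = M_{d,n} is the image of an irreducible subset of L = L_{d,n}; in particular
   there is an irreducible Z in L with s(Z) = M, the sets gZ cover L, and the
   components of L are among them.

   Dimension.  Chains of irreducible sets can be pushed forward and lifted along s,
   so it suffices to work in M, which is the variety of Gram matrices of rank at most
   d.  Such a matrix is a rational function of the D = dn - C(d+1,2) entries in its
   first d rows, so any D+1 polynomials are algebraically dependent on M (count
   monomials), whereas a chain of length k produces k independent ones.  A chain of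
   length D comes from lower triangular configurations, freeing one entry at a time.

   Irreducibility.  Along a line that moves one point in an isotropic direction all
   squared lengths are affine, with distinct zeros for a generic line; so for d >= 2
   no product of distinct m_ij is a square.  Hence the square-free monomials are
   linearly independent on Z over the polynomials in the squared coordinates, and a
   polynomial that vanishes on Z vanishes on L. *)
Require Import Defs.
From mathcomp Require Import all_boot all_algebra.
From mathcomp Require Import reals complex.
From mathcomp Require Import all_order mpoly ring zify.
From mathcomp Require boolp classical_sets.

Set Implicit Arguments.
Unset Strict Implicit.
Unset Printing Implicit Defensive.

Import Defs Order.TTheory GRing.Theory Num.Theory.
Local Open Scope ring_scope.

(** * Polynomial functions and the Zariski topology *)

Section PolynomialFunctions.
Variables (K : numClosedFieldType) (I : finType).
Implicit Types (F G : pt K I -> K) (p : {mpoly K[#|I|]}).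

Definition polyfun F := exists p, forall x, peval p x = F x.

Lemma polyfun_peval p : polyfun (peval p).
Proof. by exists p. Qed.

Lemma polyfun_cst c : polyfun (fun=> c).
Proof. by exists c%:MP => x; rewrite /peval mevalC. Qed.

Lemma polyfun_coord i : polyfun (fun x => x i).
Proof. by exists 'X_(enum_rank i) => x; rewrite /peval mevalXU enum_rankK. Qed.

Lemma polyfunD F G : polyfun F -> polyfun G -> polyfun (fun x => F x + G x).
Proof. by move=> [p hp] [q hq]; exists (p + q) => x; rewrite -hp -hq; apply: mevalD. Qed.

Lemma polyfunM F G : polyfun F -> polyfun G -> polyfun (fun x => F x * G x).
Proof. by move=> [p hp] [q hq]; exists (p * q) => x; rewrite -hp -hq; apply: mevalM. Qed.

Lemma polyfunN F : polyfun F -> polyfun (fun x => - F x).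
Proof. by move=> [p hp]; exists (- p) => x; rewrite -hp; apply: mevalN. Qed.

Lemma polyfunB F G : polyfun F -> polyfun G -> polyfun (fun x => F x - G x).
Proof. by move=> hF hG; apply: polyfunD => //; apply: polyfunN. Qed.

Lemma eq_polyfun F G : F =1 G -> polyfun F -> polyfun G.
Proof. by move=> e [p hp]; exists p => x; rewrite hp e. Qed.

Lemma polyfunX F n : polyfun F -> polyfun (fun x => F x ^+ n).
Proof.
move=> hF; elim: n => [|n IH]; first exact: polyfun_cst.
by apply: eq_polyfun (polyfunM hF IH) => x; rewrite exprS.
Qed.

Lemma polyfun_sum (T : Type) (r : seq T) (P : pred T) (F : T -> pt K I -> K) :
  (forall t, polyfun (F t)) -> polyfun (fun x => \sum_(t <- r | P t) F t x).
Proof.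
move=> hF; elim: r => [|t r IH].
  by apply: eq_polyfun (polyfun_cst 0) => x; rewrite big_nil.
case Pt: (P t); last by apply: eq_polyfun IH => x; rewrite big_cons Pt.
by apply: eq_polyfun (polyfunD (hF t) IH) => x; rewrite big_cons Pt.
Qed.

Lemma polyfun_prod (T : Type) (r : seq T) (P : pred T) (F : T -> pt K I -> K) :
  (forall t, polyfun (F t)) -> polyfun (fun x => \prod_(t <- r | P t) F t x).
Proof.
move=> hF; elim: r => [|t r IH].
  by apply: eq_polyfun (polyfun_cst 1) => x; rewrite big_nil.
case Pt: (P t); last by apply: eq_polyfun IH => x; rewrite big_cons Pt.
by apply: eq_polyfun (polyfunM (hF t) IH) => x; rewrite big_cons Pt.
Qed.

Lemma polyfun_det n (A : pt K I -> 'M[K]_n) :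
  (forall i j, polyfun (fun x => A x i j)) -> polyfun (fun x => \det (A x)).
Proof.
move=> hA; apply: polyfun_sum => s.
by apply: polyfunM; [exact: polyfun_cst | apply: polyfun_prod => i; apply: hA].
Qed.

Lemma polyfun_adj n (A : pt K I -> 'M[K]_n) i j :
  (forall i j, polyfun (fun x => A x i j)) -> polyfun (fun x => (\adj (A x)) i j).
Proof.
move=> hA; apply: (@eq_polyfun (fun x => (-1) ^+ (j + i) *
    \det (row' j (col' i (A x))))) => [x|]; first by rewrite mxE.
apply: polyfunM; first exact: polyfun_cst.
apply: polyfun_det => k l; apply: eq_polyfun (hA (lift j k) (lift i l)) => x.
by rewrite !mxE.
Qed.

(** Confines the expansion into monomials to one place: composition, restriction to lines, the
    splitting by parities and the clearing of denominators all go through this induction. *)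
Lemma polyfun_ind (P : (pt K I -> K) -> Prop) :
  (forall c, P (fun=> c)) -> (forall i, P (fun x => x i)) ->
  (forall F G, P F -> P G -> P (fun x => F x + G x)) ->
  (forall F G, P F -> P G -> P (fun x => F x * G x)) ->
  forall F, polyfun F -> P F.
Proof.
move=> hC hX hD hM F [p hp].
have Pext F1 F2 : F1 =1 F2 -> P F1 -> P F2 by move=> /boolp.funext ->.
have Pprod m : P (fun x => \prod_(i < #|I|) x (enum_val i) ^+ m i).
  elim: (index_enum _) => [|i r IH].
    by apply: Pext (hC 1) => x; rewrite big_nil.
  have Pexp k : P (fun x => x (enum_val i) ^+ k).
    elim: k => [|k IHk]; first exact: hC.
    by apply: Pext (hM _ _ (hX _) IHk) => x; rewrite exprS.
  by apply: Pext (hM _ _ (Pexp _) IH) => x; rewrite big_cons.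
suff: P (peval p) by apply: Pext.
have: P (fun x => \sum_(m <- msupp p) p@_m * \prod_(i < #|I|) x (enum_val i) ^+ m i).
  elim: (msupp p) => [|m r IH]; first by apply: Pext (hC 0) => x; rewrite big_nil.
  by apply: Pext (hD _ _ (hM _ _ (hC (p@_m)) (Pprod m)) IH) => x; rewrite big_cons.
by apply: Pext => x; rewrite /peval mevalE.
Qed.

End PolynomialFunctions.

Lemma polyfun_comp (K : numClosedFieldType) (I J : finType) (f : pt K J -> pt K I)
    (F : pt K I -> K) :
  (forall i, polyfun (fun y => f y i)) -> polyfun F -> polyfun (fun y => F (f y)).
Proof.
move=> hf; move: F.
apply: (polyfun_ind (P := fun F => polyfun (fun y => F (f y)))) => [c|i|F G|F G].
- exact: polyfun_cst.
- exact: hf.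
- exact: polyfunD.
- exact: polyfunM.
Qed.

(** * Closed sets, irreducible sets and closures *)

Section Topology.
Variables (K : numClosedFieldType) (I : finType).
Implicit Types (X Y Z W : ptset K I).

Lemma closed_cut X x : zariski_closed X -> ~ X x ->
  exists2 F, polyfun F & (forall y, X y -> F y = 0) /\ F x <> 0.
Proof.
move=> [S hS] nXx; apply: boolp.contrapT => H; apply: nXx; apply/hS => p Sp.
apply: boolp.contrapT => px; apply: H; exists (peval p); first exact: polyfun_peval.
by split=> // y /hS; apply.
Qed.

Lemma closed_of_cuts X :
  (forall x, ~ X x -> exists2 F, polyfun F & (forall y, X y -> F y = 0) /\ F x <> 0) ->
  zariski_closed X.
Proof.
move=> H; exists (fun p => forall y, X y -> peval p y = 0) => x; split=> [Xx p|Hx].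
  by apply.
apply: boolp.contrapT => /H [F [p hp] [FX]]; rewrite -hp; apply; apply: Hx => y Xy.
by rewrite hp FX.
Qed.

Lemma closed_zeros (T : Type) (F : T -> pt K I -> K) :
  (forall t, polyfun (F t)) -> zariski_closed (fun x => forall t, F t x = 0).
Proof.
move=> hF; apply: closed_of_cuts => x /boolp.existsNP [t Ht].
by exists (F t) => //; split=> // y; apply.
Qed.

Lemma eq_closed X Y : (forall x, X x <-> Y x) -> zariski_closed X -> zariski_closed Y.
Proof. by move=> e [S hS]; exists S => x; rewrite -e. Qed.

Lemma closed_inter (T : Type) (X : T -> ptset K I) :
  (forall t, zariski_closed (X t)) -> zariski_closed (fun x => forall t, X t x).
Proof.
move=> hX; apply: closed_of_cuts => x /boolp.existsNP [t Ht].
by have [F hF [F0 Fx]] := closed_cut (hX t) Ht; exists F => //; split=> // y /(_ t) /F0.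
Qed.

Lemma closedI X Y : zariski_closed X -> zariski_closed Y ->
  zariski_closed (fun x => X x /\ Y x).
Proof.
move=> hX hY; apply: (@eq_closed (fun x => forall b : bool, (if b then X else Y) x)).
  by move=> x; split=> [H|[? ?] []//]; split; [exact: (H true)|exact: (H false)].
by apply: (@closed_inter _ (fun b : bool => if b then X else Y)); case.
Qed.

Lemma closedU X Y : zariski_closed X -> zariski_closed Y ->
  zariski_closed (fun x => X x \/ Y x).
Proof.
move=> hX hY; apply: closed_of_cuts => x /boolp.not_orP [nX nY].
have [F hF [F0 Fx]] := closed_cut hX nX; have [G hG [G0 Gx]] := closed_cut hY nY.
exists (fun y => F y * G y); first exact: polyfunM.
split=> [y [/F0|/G0] ->|]; [by rewrite mul0r|by rewrite mulr0|].
by apply/eqP; rewrite mulf_neq0 //; apply/eqP.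
Qed.

Lemma closed_bigU (T : eqType) (s : seq T) (X : T -> ptset K I) :
  (forall t, zariski_closed (X t)) -> zariski_closed (fun x => exists2 t, t \in s & X t x).
Proof.
move=> hX; elim: s => [|u r IHr].
  apply: (@eq_closed (fun x => forall _ : unit, 1 = 0 :> K)).
    by move=> x; split=> [/(_ tt)/eqP|[]]//; rewrite oner_eq0.
  by apply: (@closed_zeros unit (fun=> fun=> 1)) => _; apply: polyfun_cst.
apply: eq_closed (closedU (hX u) IHr) => x; split.
  case=> [Xu|[v vr Xv]]; first by exists u; rewrite ?mem_head.
  by exists v; rewrite // in_cons vr orbT.
move=> [v]; rewrite in_cons => /orP [/eqP ->|vr Xv]; first by left.
by right; exists v.
Qed.

Lemma irreducible_prime Z F G : irreducible Z -> polyfun F -> polyfun G ->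
  (forall x, Z x -> F x * G x = 0) ->
  (forall x, Z x -> F x = 0) \/ (forall x, Z x -> G x = 0).
Proof.
move=> [_ _ hZ] hF hG FG0.
pose V (F : pt K I -> K) := fun x : pt K I => forall _ : unit, F x = 0.
have cV H : polyfun H -> zariski_closed (V H) by move=> hH; apply: closed_zeros.
have [|h|h] := hZ _ _ (cV _ hF) (cV _ hG).
- move=> x /FG0/eqP; rewrite mulf_eq0 => /orP [] /eqP e; [by left|by right].
- by left=> x /h /(_ tt).
- by right=> x /h /(_ tt).
Qed.

Lemma irreducible_cover Z (T : eqType) (s : seq T) (X : T -> ptset K I) :
  irreducible Z -> (forall t, zariski_closed (X t)) ->
  (forall x, Z x -> exists2 t, t \in s & X t x) -> exists t, subset Z (X t).
Proof.
move=> irrZ hX; have [cZ [z Zz] hZ] := irrZ; elim: s => [|t s IH] H.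
  by have [] := H z Zz.
have [|h|h] := hZ (X t) _ (hX t) (closed_bigU s hX); last by apply: IH => x /h.
- move=> x /H [u]; rewrite in_cons => /orP [/eqP -> Xt|us Xu]; first by left.
  by right; exists u.
by exists t.
Qed.

Definition zclosure X : ptset K I :=
  fun x => forall F, polyfun F -> (forall y, X y -> F y = 0) -> F x = 0.

Lemma closed_zclosure X : zariski_closed (zclosure X).
Proof.
apply: closed_of_cuts => x /boolp.existsNP [F /boolp.not_implyP [hF]].
move=> /boolp.not_implyP [F0 Fx].
by exists F => //; split=> // y; apply.
Qed.

Lemma sub_zclosure X : subset X (zclosure X).
Proof. by move=> x Xx F _; apply. Qed.

Lemma zclosure_min X Y : zariski_closed Y -> subset X Y -> subset (zclosure X) Y.
Proof.
move=> cY sXY x Xx; apply: boolp.contrapT => /(closed_cut cY) [F hF [F0]]; apply.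
by apply: Xx => // y /sXY /F0.
Qed.

Lemma eq_irreducible X Y : (forall x, X x <-> Y x) -> irreducible X -> irreducible Y.
Proof.
by move=> e; have -> : X = Y by apply: boolp.funext => x; apply: boolp.propext.
Qed.

End Topology.

Lemma closed_preim (K : numClosedFieldType) (I J : finType) (f : pt K J -> pt K I)
    (X : ptset K I) :
  (forall i, polyfun (fun y => f y i)) -> zariski_closed X ->
  zariski_closed (fun y => X (f y)).
Proof.
move=> hf hX; apply: closed_of_cuts => x /(closed_cut hX) [F hF [F0 Fx]].
exists (fun y => F (f y)); first exact: polyfun_comp.
by split=> // y /F0.
Qed.

(** * Restriction of polynomial functions to lines *)

Section Lines.
Variable K : numClosedFieldType.

Lemma horner_eq0 (p : {poly K}) : (forall t, p.[t] = 0) -> p = 0.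
Proof.
move=> H; apply/eqP; apply: contraT => nz_p.
pose s := [seq i%:R : K | i <- iota 0 (size p)].
have: (size s < size p)%N.
  apply: max_poly_roots => //; first by apply/allP => x _; apply/rootP.
  by rewrite map_inj_uniq ?iota_uniq // => i j /eqP; rewrite eqr_nat => /eqP.
by rewrite size_map size_iota ltnn.
Qed.

Lemma polyfun_line (I : finType) (F : pt K I -> K) (a w : pt K I) : polyfun F ->
  exists p : {poly K}, forall t, p.[t] = F (fun i => a i + t * w i).
Proof.
move: F; apply: (polyfun_ind (P := fun F =>
  exists p : {poly K}, forall t, p.[t] = F (fun i => a i + t * w i))) => [c|i|F G|F G].
- by exists c%:P => t; rewrite hornerC.
- by exists ((a i)%:P + 'X * (w i)%:P) => t; rewrite !hornerE.
- by move=> [p hp] [q hq]; exists (p + q) => t; rewrite hornerD hp hq.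
- by move=> [p hp] [q hq]; exists (p * q) => t; rewrite hornerM hp hq.
Qed.

(** On the line through [a] and [b] both functions are nonzero polynomials in one variable, so their
    product is a nonzero polynomial and has a nonzero value. *)
Lemma polyfun_domain (I : finType) (F G : pt K I -> K) a b :
  polyfun F -> polyfun G -> F a != 0 -> G b != 0 -> exists x, F x * G x != 0.
Proof.
move=> hF hG Fa Gb; apply: boolp.contrapT => /boolp.forallNP H.
have [p hp] := polyfun_line a (fun i => b i - a i) hF.
have [q hq] := polyfun_line a (fun i => b i - a i) hG.
have /eqP : p * q = 0.
  apply: horner_eq0 => t; rewrite hornerM hp hq.
  by apply/eqP; apply: contraT => ne; case: (H _ ne).
rewrite mulf_eq0 => /orP [] /eqP e.
  case/eqP: Fa; have := hp 0; rewrite e horner0 => ->.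
  by congr F; apply: boolp.funext => i; rewrite mul0r addr0.
case/eqP: Gb; have := hq 1; rewrite e horner0 => ->.
by congr G; apply: boolp.funext => i; rewrite mul1r addrC subrK.
Qed.

Lemma polyfun_common_nonzero (I : finType) (T : eqType) (s : seq T) (F : T -> pt K I -> K) :
  (forall t, polyfun (F t)) -> (forall t, t \in s -> exists x, F t x != 0) ->
  exists x, forall t, t \in s -> F t x != 0.
Proof.
move=> hF; elim: s => [|t s IH] H; first by exists (fun=> 0).
have [a Fa] := H t (mem_head _ _).
have [|b Fb] := IH; first by move=> u us; apply: H; rewrite in_cons us orbT.
have [||x] := @polyfun_domain _ (F t) (fun x => \prod_(u <- s) F u x) a b (hF t) _ Fa.
- exact: polyfun_prod.
- by rewrite prodf_seq_neq0; apply/allP => u us; apply: Fb.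
rewrite mulf_eq0 negb_or prodf_seq_neq0 => /andP [Ft /allP Fs]; exists x => u.
by rewrite in_cons => /orP [/eqP -> //|/Fs].
Qed.

(** If the image lay in neither set, equations [F] of [Y] and [G] of [Z] pulled back along [f] would
    both be nonzero at some common [y], although [f y] lies in [Y] or in [Z]. *)
Lemma irreducible_image (I J : finType) (f : pt K J -> pt K I) :
  (forall i, polyfun (fun y => f y i)) ->
  irreducible (zclosure (fun x => exists y, f y = x)).
Proof.
move=> hf; split; first exact: closed_zclosure.
  by exists (f (fun=> 0)); apply: sub_zclosure; exists (fun=> 0).
move=> Y Z cY cZ H.
suff: (forall y, Y (f y)) \/ (forall y, Z (f y)).
  by case=> h; [left|right]; apply: zclosure_min => // _ [y <-].
apply: boolp.contrapT => /boolp.not_orP [/boolp.existsNP [a Ya] /boolp.existsNP [b Zb]].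
have [F hF [F0 Fa]] := closed_cut cY Ya; have [G hG [G0 Gb]] := closed_cut cZ Zb.
have [||||y] := @polyfun_domain _ (fun y => F (f y)) (fun y => G (f y)) a b.
- exact: polyfun_comp.
- exact: polyfun_comp.
- exact/eqP.
- exact/eqP.
case/eqP; have [|/F0 ->|/G0 ->] := H (f y); last by rewrite mulr0.
  by apply: sub_zclosure; exists y.
by rewrite mul0r.
Qed.

End Lines.

(** * Independence of square roots *)

Section SquareRoots.
Variables (K : numClosedFieldType) (T : Type) (I : eqType) (b : I -> T -> K).
Implicit Types (E N : (T -> K) -> Prop) (f g u v : T -> K) (l : seq I) (s : bitseq).

Definition subring E :=
  [/\ E (fun=> 1), forall f g, E f -> E g -> E (fun x => f x - g x)
    & forall f g, E f -> E g -> E (fun x => f x * g x)].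

(** The ring [E[b i]]: degree one in [b i] is enough once the square of [b i] lies in [E]. *)
Definition adj E i f := exists u v, [/\ E u, E v & f = fun x => u x + b i x * v x].

Definition adjs E l := foldl adj E l.

Definition bprod s l x := \prod_(i <- mask s l) b i x.

(* The combination of the products [bprod s l], with [s] of size [size l] and
   coefficients [c s], in a form that can be re-bracketed as a combination over
   the tail of [l] with coefficients in the adjunction of the head. *)
Fixpoint lincomb l (c : bitseq -> T -> K) : T -> K :=
  if l is i :: l' then
    lincomb l' (fun s x => c (false :: s) x + b i x * c (true :: s) x)
  else c [::].

Lemma eq_mem_fun E f g : f =1 g -> E f -> E g.
Proof. by move/boolp.funext ->. Qed.

Lemma subring0 E : subring E -> E (fun=> 0).
Proof. by move=> [E1 EB _]; apply: eq_mem_fun (EB _ _ E1 E1) => x; rewrite subrr. Qed.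

Lemma subringD E f g : subring E -> E f -> E g -> E (fun x => f x + g x).
Proof.
move=> sE Ef Eg; have [_ EB _] := sE.
apply: eq_mem_fun (EB _ _ Ef (EB _ _ (subring0 sE) Eg)) => x.
by rewrite sub0r opprK.
Qed.

Lemma sub_adj E i f : subring E -> E f -> adj E i f.
Proof.
move=> sE Ef; exists f, (fun=> 0); split=> //; first exact: subring0.
by apply: boolp.funext => x; rewrite mulr0 addr0.
Qed.

Lemma subring_adj E i : subring E -> E (fun x => b i x ^+ 2) -> subring (adj E i).
Proof.
move=> sE Ei; have [E1 EB EM] := sE; split; first exact: sub_adj.
- move=> _ _ [u [v [Eu Ev ->]]] [u' [v' [Eu' Ev' ->]]].
  exists (fun x => u x - u' x), (fun x => v x - v' x); split; try exact: EB.
  by apply: boolp.funext => x; ring.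
- move=> _ _ [u [v [Eu Ev ->]]] [u' [v' [Eu' Ev' ->]]].
  exists (fun x => u x * u' x + b i x ^+ 2 * (v x * v' x)),
         (fun x => u x * v' x + v x * u' x).
  split; [| |by apply: boolp.funext => x; ring].
    by apply: subringD => //; [apply: (EM)|apply: (EM _ _ Ei); apply: (EM)].
  by apply: subringD => //; apply: (EM).
Qed.

Lemma adjs_subring l E : subring E -> (forall i, i \in l -> E (fun x => b i x ^+ 2)) ->
  [/\ subring (adjs E l), (forall f, E f -> adjs E l f)
    & forall i, i \in l -> adjs E l (b i)].
Proof.
elim: l E => [|i l IH] E sE El; first by split.
have Ei : E (fun x => b i x ^+ 2) by apply: El; rewrite mem_head.
have [||h1 h2 h3] := IH (adj E i); first exact: subring_adj.
  by move=> j jl; apply: sub_adj => //; apply: El; rewrite in_cons jl orbT.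
split=> // [f Ef|j]; first by apply: h2; apply: sub_adj.
rewrite in_cons => /orP [/eqP ->|/h3 //]; apply: h2.
exists (fun=> 0), (fun=> 1); split; [exact: subring0|by case: sE|].
by apply: boolp.funext => x; rewrite mulr1 add0r.
Qed.

Lemma eq_lincomb l (c c' : bitseq -> T -> K) :
  (forall s, size s = size l -> c s = c' s) -> lincomb l c = lincomb l c'.
Proof.
elim: l c c' => [|i l IH] c c' H; first exact: H.
by apply: IH => s ss; rewrite !H //= ss.
Qed.

(** The head is adjoined first, so the coefficients over the tail lie in [adj E i], and each splits
    into two coefficients in [E]. *)
Lemma adjs_lincomb l E f : adjs E l f ->
  exists2 c, (forall s, size s = size l -> E (c s)) & f = lincomb l c.
Proof.
elim: l E => [|i l IH] E; first by move=> Ef; exists (fun=> f).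
case/IH => c hc ->.
have /boolp.choice [uv huv] s : exists uv : (T -> K) * (T -> K), size s = size l ->
    [/\ E uv.1, E uv.2 & c s = fun x => uv.1 x + b i x * uv.2 x].
  have [/hc [u [v H]]|ne] := eqVneq (size s) (size l); first by exists (u, v).
  by exists (c s, c s) => e; rewrite e eqxx in ne.
exists (fun s => if s is a :: s' then if a then (uv s').2 else (uv s').1 else c [::]).
  by move=> [//|[] s] [/huv []].
by apply: eq_lincomb => s /huv [_ _ ->].
Qed.

Lemma lincomb_eq0 l c x : (forall s, size s = size l -> c s x * bprod s l x = 0) ->
  lincomb l c x = 0.
Proof.
elim: l c => [|i l IH] c H.
  by have := H [::] erefl; rewrite /bprod big_nil mulr1.
apply: IH => s ss; have /= := H (false :: s); have /= := H (true :: s).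
rewrite /bprod /= big_cons ss => /(_ erefl) h1 /(_ erefl) h2.
by rewrite /bprod mulrDl h2 add0r -[RHS]h1; ring.
Qed.

(* Flipping the sign of each root in turn isolates the terms of a combination. *)
Lemma lincomb_flip (N : (T -> K) -> Prop) (flip : I -> T -> T) l c :
  (forall f g, N f -> N g -> N (fun x => f x + g x)) ->
  (forall a f, N f -> N (fun x => a * f x)) ->
  (forall i f, N f -> N (fun x => f (flip i x))) ->
  uniq l -> (forall i x, b i (flip i x) = - b i x) ->
  (forall i j x, j != i -> b j (flip i x) = b j x) ->
  (forall s i x, size s = size l -> i \in l -> c s (flip i x) = c s x) ->
  N (lincomb l c) ->
  forall s, size s = size l -> N (fun x => c s x * bprod s l x).
Proof.
move=> ND NZ Nflip + bi bj.
elim: l c => [|i l IH] c.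
  move=> _ _ Nc [|//] _; apply: eq_mem_fun Nc => x.
  by rewrite /bprod big_nil mulr1.
move=> /= /andP [il ul] hc /IH H s.
have {}H s' : size s' = size l ->
    N (fun x => (c (false :: s') x + b i x * c (true :: s') x) * bprod s' l x).
  apply: H => // s2 j x ss2 jl; rewrite bj ?hc /= ?ss2 ?in_cons ?jl ?orbT //.
  by apply: contraNneq il => ->.
case: s => [//|a s] [ss].
have Hm := Nflip i _ (H _ ss).
have flip_bprod x : bprod s l (flip i x) = bprod s l x.
  rewrite /bprod; apply: eq_big_seq => j /mem_mask jl; apply: bj.
  by apply: contraNneq il => <-.
have n2 : 2%:R != 0 :> K by rewrite pnatr_eq0.
(* Half the difference of the combination and its flip isolates the term with [b i], half the sum
   the term without it. *)
case: a.
  apply: eq_mem_fun (NZ 2%:R^-1 _ (ND _ _ (H _ ss) (NZ (-1) _ Hm))) => x /=.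
  rewrite flip_bprod bi !hc /= ?ss ?mem_head // /bprod /= big_cons.
  by field.
apply: eq_mem_fun (NZ 2%:R^-1 _ (ND _ _ (H _ ss) Hm)) => x /=.
by rewrite flip_bprod bi !hc /= ?ss ?mem_head // /bprod /=; field.
Qed.

Section Independence.
Variables (Z : T -> Prop) (B : (T -> K) -> Prop).
Let N f := forall x, Z x -> f x = 0.
Hypothesis subB : subring B.
Hypothesis Bb : forall i, B (b i).
Hypothesis Bprime : forall f g, B f -> B g -> N (fun x => f x * g x) -> N f \/ N g.

Definition nonsquare E l := forall s, size s = size l -> true \in s ->
  forall u v, E u -> E v -> N (fun x => v x * bprod s l x - u x) -> N v.

(* If all products of square roots stay outside the fraction field of [E], this
   persists after adjoining the first root: [w * bprod = p + q * b] with
   [w, p, q] in [E] forces [p * q = 0] after squaring. *)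
Lemma nonsquare_adj E i l : subring E -> (forall f, E f -> B f) ->
  (forall j, j \in i :: l -> E (fun x => b j x ^+ 2)) ->
  nonsquare E (i :: l) -> nonsquare (adj E i) l.
Proof.
move=> sE EB Esq nsq s ss ts _ _ [u [u' [Eu Eu' ->]]] [v [v' [Ev Ev' ->]]] H.
have [E1 ES EM] := sE; have ED := subringD sE.
have Ei : E (fun x => b i x ^+ 2) by apply: Esq; rewrite mem_head.
(* The three instances needed: the root [b i] alone, the product over [l] alone, and both
   together. *)
have nsqi f g : E f -> E g -> N (fun x => g x * b i x - f x) -> N g.
  move=> Ef Eg h; apply: (nsq (true :: nseq (size l) false) _ _ f g) => //=.
  - by rewrite size_nseq.
  - move=> x /h; rewrite /bprod /= big_cons => <-.
    by rewrite mask_false big_nil mulr1.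
have nsqf f g : E f -> E g -> N (fun x => g x * bprod s l x - f x) -> N g.
  by move=> Ef Eg h; apply: (nsq (false :: s) _ _ f g) => //=; rewrite ss.
have nsqt f g : E f -> E g -> N (fun x => g x * (b i x * bprod s l x) - f x) -> N g.
  move=> Ef Eg h; apply: (nsq (true :: s) _ _ f g) => //=; first by rewrite ss.
  by move=> x /h; rewrite /bprod /= big_cons.
(* Multiplying [H] by the conjugate [v - b i * v'] turns the coefficient of the product into the
   norm [w], which lies in [E]. *)
pose w x := v x ^+ 2 - b i x ^+ 2 * v' x ^+ 2.
pose p x := u x * v x - b i x ^+ 2 * (u' x * v' x).
pose q x := u' x * v x - u x * v' x.
have E2 f : E f -> E (fun x => f x ^+ 2).
  by move=> Ef; apply: eq_mem_fun (EM _ _ Ef Ef) => x; rewrite expr2.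
have Ew : E w by apply: (ES); [exact: E2|apply: (EM) => //; exact: E2].
have Ep : E p by apply: (ES); [exact: EM|apply: (EM) => //; exact: EM].
have Eq : E q by apply: (ES); exact: EM.
have Hw : N (fun x => w x * bprod s l x - (p x + b i x * q x)).
  move=> x Zx; rewrite /w /p /q.
  transitivity (((v x + b i x * v' x) * bprod s l x - (u x + b i x * u' x)) *
                (v x - b i x * v' x)); first by ring.
  by rewrite (H x Zx) mul0r.
(* If the norm vanishes, so does one of its two factors. The first is the goal; if it is the
   conjugate, [b i * v' = v] and [nsqi] gives [v' = 0], hence [v = 0]. *)
suff Nw : N w.
  have [] := Bprime _ _ (_ : N (fun x => (v x + b i x * v' x) * (v x - b i x * v' x))).
  - by apply: subringD => //; [exact: EB|case: subB => _ _; apply=> //; exact: EB].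
  - case: subB => _ BS BM; apply: BS; first exact: EB.
    by apply: (BM) => //; exact: EB.
  - by move=> x Zx; rewrite -[RHS](Nw x Zx) /w; ring.
  - by [].
  - move=> h; have v'0 : N v'.
      apply: (nsqi v v') => // x Zx.
      transitivity (- (v x - b i x * v' x)); first by ring.
      by rewrite (h x Zx) oppr0.
    by move=> x Zx; have := h x Zx; rewrite v'0 // mulr0 subr0 addr0.
have Ebp : E (fun x => bprod s l x ^+ 2).
  apply: (@eq_mem_fun _ (fun x => \prod_(j <- mask s l) b j x ^+ 2)).
    by move=> x; rewrite /bprod prodrXl.
  have: {subset mask s l <= l} by move=> j /mem_mask.
  elim: (mask s l) => [|j r IHr] rl.
    by apply: eq_mem_fun E1 => x; rewrite big_nil.
  apply: (@eq_mem_fun _ (fun x => b j x ^+ 2 * \prod_(k <- r) b k x ^+ 2)).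
    by move=> x; rewrite big_cons.
  apply: (EM); last by apply: IHr => k kr; apply: rl; rewrite in_cons kr orbT.
  by apply: Esq; rewrite in_cons rl ?mem_head ?orbT.
have Npq : N (fun x => p x * q x).
  have h : N (fun x => p x * q x + p x * q x).
    apply: (nsqi (fun x => w x ^+ 2 * bprod s l x ^+ 2 -
                           (p x ^+ 2 + b i x ^+ 2 * q x ^+ 2))).
    - apply: (ES); first by apply: (EM) => //; exact: E2.
      by apply: (ED); [exact: E2|apply: (EM) => //; exact: E2].
    - by apply: (ED); exact: EM.
    - move=> x Zx.
      transitivity (- ((w x * bprod s l x - (p x + b i x * q x)) *
                       (w x * bprod s l x + (p x + b i x * q x)))); first by ring.
      by rewrite (Hw x Zx) mul0r oppr0.
  by move=> x /h /eqP; rewrite -mulr2n mulrn_eq0 /= => /eqP.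
(* With [p = 0], [w] times [b i * bprod s l] is [b i ^+ 2 * q]; with [q = 0], [w * bprod s l] is
   [p]. Both contradict nonsquareness unless [w = 0]. *)
have [Np|Nq] := Bprime (EB _ Ep) (EB _ Eq) Npq.
  apply: (nsqt (fun x => b i x ^+ 2 * q x)) => //; first exact: EM.
  move=> x Zx; transitivity ((w x * bprod s l x - (p x + b i x * q x) + p x) * b i x).
    by ring.
  by rewrite (Hw x Zx) (Np x Zx) addr0 mul0r.
apply: (nsqf p) => // x Zx.
transitivity (w x * bprod s l x - (p x + b i x * q x) + b i x * q x); first by ring.
by rewrite (Hw x Zx) (Nq x Zx) mulr0 addr0.
Qed.

(** By [nonsquare_adj] the tail can be treated over [adj E i]. This leaves
    [c (false :: s) + b i * c (true :: s) = 0] on [Z], and nonsquareness of [b i] itself kills both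
    coefficients. *)
Lemma lincomb_indep l E c : subring E -> (forall f, E f -> B f) ->
  (forall j, j \in l -> E (fun x => b j x ^+ 2)) -> nonsquare E l ->
  (forall s, size s = size l -> E (c s)) -> N (lincomb l c) ->
  forall s, size s = size l -> N (c s).
Proof.
elim: l E c => [|i l IH] E c sE EB Esq nsq Ec Nc; first by case.
have Ei : E (fun x => b i x ^+ 2) by apply: Esq; rewrite mem_head.
have H s : size s = size l -> N (fun x => c (false :: s) x + b i x * c (true :: s) x).
  apply: (IH (adj E i) (fun s x => c (false :: s) x + b i x * c (true :: s) x)) => //.
  - exact: subring_adj.
  - move=> _ [u [v [Eu Ev ->]]]; apply: subringD => //; first exact: EB.
    by case: subB => _ _; apply=> //; exact: EB.
  - by move=> j jl; apply: sub_adj => //; apply: Esq; rewrite in_cons jl orbT.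
  - exact: nonsquare_adj.
  - move=> s' ss'; exists (c (false :: s')), (c (true :: s')).
    by split=> //; apply: Ec => /=; rewrite ss'.
have Ht s : size s = size l -> N (c (true :: s)).
  move=> ss; apply: (nsq (true :: nseq (size l) false) _ _ (fun x => 0 - c (false :: s) x)).
  - by rewrite /= size_nseq.
  - by rewrite mem_head.
  - case: (sE) => _ ES _; apply: (ES); first exact: subring0.
    by apply: Ec; rewrite /= ss.
  - by apply: Ec; rewrite /= ss.
  - move=> x Zx; rewrite /bprod /= big_cons mask_false big_nil mulr1.
    by rewrite -[RHS](H s ss x Zx); ring.
case=> [//|[] s] [ss]; first exact: Ht.
by move=> x Zx; have := H s ss x Zx; rewrite (Ht s ss x Zx) mulr0 addr0.
Qed.

End Independence.

End SquareRoots.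

(** * The squaring map *)

Section Squaring.
Variables (K : numClosedFieldType) (I : finType).
Implicit Types (x y : pt K I) (X Y Z W : ptset K I) (g : {ffun I -> bool}).

Definition sqp x : pt K I := fun i => x i ^+ 2.

Definition sgn g x : pt K I := fun i => (-1) ^+ g i * x i.

Definition sqim X : ptset K I := fun y => exists2 x, X x & sqp x = y.

Lemma sgnK g : involutive (sgn g).
Proof. by move=> x; apply: boolp.funext => i; rewrite /sgn mulrA -expr2 sqrr_sign mul1r. Qed.

Lemma sqp_sgn g x : sqp (sgn g x) = sqp x.
Proof. by apply: boolp.funext => i; rewrite /sqp /sgn exprMn sqrr_sign mul1r. Qed.

Lemma sqp_fiber x x' : sqp x = sqp x' -> exists g, x' = sgn g x.
Proof.
move=> e; exists [ffun i => x' i != x i]; apply: boolp.funext => i.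
rewrite /sgn ffunE; have := congr1 (@^~ i) e; rewrite /sqp /= => /eqP.
rewrite eqf_sqr; have [->|ne] := eqVneq (x' i) (x i); first by rewrite mul1r.
by rewrite orFb => /eqP ->; rewrite expr1 mulN1r opprK.
Qed.

Lemma sqp_surj y : exists x, sqp x = y.
Proof. by exists (fun i => sqrtC (y i)); apply: boolp.funext => i; apply: sqrtCK. Qed.

Lemma polyfun_sqp i : polyfun (fun x => sqp x i).
Proof. by apply: polyfunX; apply: polyfun_coord. Qed.

Lemma polyfun_sgn g i : polyfun (fun x => sgn g x i).
Proof. by apply: polyfunM; [apply: polyfun_cst|apply: polyfun_coord]. Qed.

Definition evenfun (f : pt K I -> K) := exists2 h, polyfun h & f = fun x => h (sqp x).

Lemma subring_evenfun : subring evenfun.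
Proof.
split; first by exists (fun=> 1) => //; apply: polyfun_cst.
  move=> _ _ [h hp ->] [k kp ->]; exists (fun x => h x - k x) => //.
  exact: polyfunB.
move=> _ _ [h hp ->] [k kp ->]; exists (fun x => h x * k x) => //.
exact: polyfunM.
Qed.

Lemma evenfun_sqr i : evenfun (fun x => x i ^+ 2).
Proof. by exists (fun x => x i) => //; apply: polyfun_coord. Qed.

Local Notation coord := (fun i (x : pt K I) => x i).

(** Adjoining all coordinates to [evenfun] gives a ring with all constants and coordinates. The
    combination groups monomials by the parities of their exponents. *)
Lemma polyfun_lincomb F : polyfun F ->
  exists2 c, (forall s, size s = size (enum I) -> evenfun (c s)) &
             F = lincomb coord (enum I) c.
Proof.
move=> hF; apply: adjs_lincomb; move: F hF.
have [|i _|[_ AB AM] AE Ai] := @adjs_subring K _ _ coord (enum I) evenfun.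
- exact: subring_evenfun.
- exact: evenfun_sqr.
have sA : subring (adjs coord evenfun (enum I)).
  by split=> //; apply: AE; case: subring_evenfun.
apply: polyfun_ind => [c|i|F G FA GA|F G FA GA].
- by apply: AE; exists (fun=> c) => //; apply: polyfun_cst.
- by apply: Ai; rewrite mem_enum.
- exact: subringD.
- exact: AM.
Qed.

(** For [y = sqp x] outside the image, some [F] vanishes on the union [Y'] of the sign translates of
    [Y] but not at [x]. Sign flips show that each term of [F] vanishes on [Y']. A term that is
    nonzero at [x], multiplied by its square-free monomial, is a polynomial in the squares and
    separates [y] from the image. *)
Lemma closed_sqim Y : zariski_closed Y -> zariski_closed (sqim Y).
Proof.
move=> cY; pose Y' x := exists2 g, g \in enum {ffun I -> bool} & Y (sgn g x).
have cY' : zariski_closed Y'.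
  apply: (@closed_bigU _ _ _ _ (fun g x => Y (sgn g x))) => g.
  by apply: closed_preim cY => i; apply: polyfun_sgn.
apply: closed_of_cuts => y nYy; have [x xy] := sqp_surj y.
have nY'x : ~ Y' x.
  by move=> [g _ Yg]; apply: nYy; exists (sgn g x) => //; rewrite sqp_sgn.
have [F hF [F0 Fx]] := closed_cut cY' nY'x.
have [c hc Fc] := polyfun_lincomb hF.
have [s /boolp.not_implyP [ss csx]] :
    exists s, ~ (size s = size (enum I) -> c s x * bprod coord s (enum I) x = 0).
  by apply/boolp.existsNP => H; apply: Fx; rewrite Fc; apply: lincomb_eq0.
have c0 : forall x, Y' x -> c s x * bprod coord s (enum I) x = 0.
  apply: (@lincomb_flip K _ _ coord (fun f => forall x, Y' x -> f x = 0)
    (fun i => sgn [ffun j => j == i]) (enum I) c _ _ _ _ _ _ _ _ s ss).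
  - by move=> f f' f0 f'0 z Yz; rewrite f0 // f'0 // addr0.
  - by move=> a f f0 z Yz; rewrite f0 // mulr0.
  - move=> i f f0 z [g _ Yg]; apply: f0.
    exists [ffun j => g j (+) (j == i)]; first by rewrite mem_enum.
    suff -> : sgn [ffun j => g j (+) (j == i)] (sgn [ffun j => j == i] z) = sgn g z by [].
    apply: boolp.funext => j; rewrite /sgn !ffunE mulrA -signr_addb.
    by rewrite -addbA addbb addbF.
  - exact: enum_uniq.
  - by move=> i z; rewrite /sgn ffunE eqxx expr1 mulN1r.
  - by move=> i j z /negbTE ji; rewrite /sgn ffunE ji mul1r.
  - by move=> s' i z ss' _; have [h _ ->] := hc _ ss'; rewrite sqp_sgn.
  - by rewrite -Fc.
have [h hh hE] := hc s ss.
have hsq z : h (sqp z) * \prod_(i <- mask s (enum I)) sqp z i =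
    c s z * bprod coord s (enum I) z * bprod coord s (enum I) z.
  by rewrite hE /bprod /sqp prodrXl expr2 mulrA.
exists (fun z => h z * \prod_(i <- mask s (enum I)) z i).
  by apply: polyfunM => //; apply: polyfun_prod => i; apply: polyfun_coord.
split=> [_ [z Yz <-]|].
  rewrite hsq c0 ?mul0r //; exists [ffun=> false]; first by rewrite mem_enum.
  suff -> : sgn [ffun=> false] z = z by [].
  by apply: boolp.funext => i; rewrite /sgn ffunE mul1r.
rewrite -xy hsq => /eqP; move/eqP: csx; rewrite !mulf_eq0 negb_or.
by move=> /andP [/negbTE -> /negbTE ->].
Qed.

Lemma irreducible_sqim Z : irreducible Z -> irreducible (sqim Z).
Proof.
move=> [cZ [z Zz] hZ]; split; first exact: closed_sqim.
  by exists (sqp z), z.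
move=> Y1 Y2 c1 c2 H.
have cp Y : zariski_closed Y -> zariski_closed (fun x => Y (sqp x)).
  by apply: closed_preim => i; apply: polyfun_sqp.
have [|h|h] := hZ _ _ (cp _ c1) (cp _ c2).
- by move=> x Zx; apply: H; exists x.
- by left=> _ [x Zx <-]; apply: h.
- by right=> _ [x Zx <-]; apply: h.
Qed.

Lemma irreducible_sgn g Z : irreducible Z -> irreducible (fun x => Z (sgn g x)).
Proof.
have cp Y : zariski_closed Y -> zariski_closed (fun x => Y (sgn g x)).
  by apply: closed_preim => i; apply: polyfun_sgn.
move=> [cZ [z Zz] hZ]; split; first exact: cp.
  by exists (sgn g z); rewrite sgnK.
move=> Y1 Y2 c1 c2 H; have [|h|h] := hZ _ _ (cp _ c1) (cp _ c2).
- by move=> x Zx; apply: H; rewrite sgnK.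
- by left=> x /h; rewrite sgnK.
- by right=> x /h; rewrite sgnK.
Qed.

(* Zorn's lemma gives a minimal closed subset of [Y] that still maps onto [W]:
   the fibres of [sqp] are finite, so decreasing intersections keep mapping onto
   [W], and a decomposition of a minimal one would decompose [W]. *)
Lemma lift_irreducible Y W : zariski_closed Y -> irreducible W -> subset W (sqim Y) ->
  exists Z, [/\ irreducible Z, subset Z Y & forall y, W y <-> sqim Z y].
Proof.
move=> cY0 irrW WY0; pose Y1 x := Y x /\ W (sqp x).
have [cW [w Ww] hW] := irrW.
have cY1 : zariski_closed Y1.
  by apply: closedI => //; apply: closed_preim cW => i; apply: polyfun_sqp.
have WY1 : subset W (sqim Y1).
  by move=> y Wy; have [x Yx xy] := WY0 y Wy; exists x; rewrite // /Y1 xy.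
pose P Z := [/\ zariski_closed Z, subset Z Y1 & subset W (sqim Z)].
pose t0 : {Z | P Z} := exist _ Y1 (And3 cY1 (fun _ h => h) WY1).
(* Reversed inclusion, so that Zorn's lemma yields a minimal set. *)
pose R (Z1 Z2 : {Z | P Z}) := boolp.asbool (subset (sval Z2) (sval Z1)).
have [|||[Z [cZ ZY1 WZ]] minZ] := @classical_sets.ZL_preorder {Z | P Z} t0 R.
- by move=> Z; apply/boolp.asboolP.
- move=> Z1 Z2 Z3 /boolp.asboolP h1 /boolp.asboolP h2; apply/boolp.asboolP.
  by move=> x /h2 /h1.
- move=> A totA; pose V x := Y1 x /\ forall t : {Z | P Z}, A t -> sval t x.
  have cV : zariski_closed V.
    apply: closedI => //; apply: closed_inter => t.
    case: (boolp.pselect (A t)) => At.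
      have [c _ _] := svalP t.
      by apply: eq_closed c => x; split=> [h _|]; [exact: h|apply].
    (* For [t] outside [A] the condition is void: the whole space, given by no equations. *)
    by exists (fun=> False) => x; split.
  have WV : subset W (sqim V).
    move=> y Wy; have [x0 x0y] := sqp_surj y; apply: boolp.contrapT => nV.
    have nVg g : ~ V (sgn g x0).
      by move=> Vg; apply: nV; exists (sgn g x0); rewrite // sqp_sgn.
    (* Induction over the finitely many sign vectors: one set, from the chain or [t0] to start with,
       already misses the whole fibre over [y]. *)
    have [t [_ Ht]] : exists t : {Z | P Z}, (t = t0 \/ A t) /\
        forall g, g \in enum {ffun I -> bool} -> ~ sval t (sgn g x0).
      elim: (enum _) => [|g gs [t [At Ht]]]; first by exists t0; split=> //; left.
      have [Yg|nYg] := boolp.pselect (Y1 (sgn g x0)); last first.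
        exists t; split=> // g'; rewrite in_cons => /orP [/eqP -> tg|]; last exact: Ht.
        by apply: nYg; have [_ h _] := svalP t; apply: h.
      have [t2 At2 nt2] : exists2 t2, A t2 & ~ sval t2 (sgn g x0).
        apply: boolp.contrapT => H; apply: (nVg g); split=> // t2 At2.
        by apply: boolp.contrapT => nt2; apply: H; exists t2.
      have [sub|sub] : subset (sval t2) (sval t) \/ subset (sval t) (sval t2).
        case: At => [->|At]; first by left; have [_ h _] := svalP t2.
        by have [/boolp.asboolP|/boolp.asboolP] := totA _ _ At At2; [left|right].
      + exists t2; split; first by right.
        move=> g'; rewrite in_cons => /orP [/eqP -> //|/Ht nt /sub]; exact: nt.
      + exists t; split=> // g'; rewrite in_cons => /orP [/eqP ->|/Ht //].
        by move=> /sub.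
    have [_ _ /(_ y Wy) [x tx xy]] := svalP t.
    have [g xg] : exists g, x = sgn g x0 by apply: sqp_fiber; rewrite xy.
    by apply: (Ht g); rewrite ?mem_enum // -xg.
  have VP : P V by split=> // x [].
  exists (exist _ V VP) => t At; apply/boolp.asboolP => x [_]; exact.
have {}minZ Z' : P Z' -> subset Z' Z -> subset Z Z'.
  move=> PZ' Z'Z; have := minZ (exist _ Z' PZ'); rewrite /R /=.
  by move=> h; apply/boolp.asboolP/h/boolp.asboolP.
exists Z; split; last 1 first.
- by move=> y; split=> [/WZ //|[x Zx <-]]; have [] := ZY1 x Zx.
- split=> //; first by have [x Zx _] := WZ w Ww; exists x.
  move=> Z1 Z2 c1 c2 H.
  have cc Z' : zariski_closed Z' -> zariski_closed (fun x => Z x /\ Z' x).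
    exact: closedI.
  have step Z' : zariski_closed Z' -> subset W (sqim (fun x => Z x /\ Z' x)) ->
      subset Z Z'.
    move=> c' W' x Zx.
    have h : P (fun x => Z x /\ Z' x) by split=> //; [exact: cc|move=> z [/ZY1]].
    have sub : subset (fun x => Z x /\ Z' x) Z by move=> z [].
    by have [] := minZ _ h sub x Zx.
  have [|h|h] := hW _ _ (closed_sqim (cc _ c1)) (closed_sqim (cc _ c2)).
  + move=> y /WZ [x Zx xy]; have [hx|hx] := H x Zx; [left|right]; by exists x.
  + by left; apply: step.
  + by right; apply: step.
- by move=> x /ZY1 [].
Qed.

(** Lifting goes from the top down: below a lift [Zk] of [W k.+1], the rest of the chain is lifted
    inside the part of [Zk] over [W k], which is closed and maps onto [W k]. *)
Lemma lift_irr_chain k (W : nat -> ptset K I) X Y :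
  irr_chain X k W -> zariski_closed Y -> subset (W k) (sqim Y) ->
  exists Z : nat -> ptset K I, irr_chain Y k Z /\
    forall i, (i <= k)%N -> forall y, W i y <-> sqim (Z i) y.
Proof.
elim: k X Y => [|k IH] X Y [irrW WX Wlt] cY WY.
  have [Z [irrZ ZY ZW]] := lift_irreducible cY (irrW 0%N (leqnn _)) WY.
  exists (fun=> Z); split; last by move=> i; rewrite leqn0 => /eqP ->.
  by split.
have [Zk [irrZk ZkY ZkW]] := lift_irreducible cY (irrW k.+1 (leqnn _)) WY.
have [cZk _ _] := irrZk.
have [cWk _ _] := irrW k (leqnSn k).
have [|||Z [[irrZ ZY' Zlt] ZW]] := IH X (fun x => Zk x /\ W k (sqp x)).
- by split=> i ik; [apply: irrW|apply: WX|apply: Wlt]; apply: leqW.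
- by apply: closedI => //; apply: closed_preim cWk => i; apply: polyfun_sqp.
- move=> y Wy; have [sWW _] := Wlt k (ltnSn k).
  by have /ZkW [x Zx xy] := sWW y Wy; exists x; rewrite // xy.
exists (fun i => if (i <= k)%N then Z i else Zk); split; last first.
  move=> i; rewrite leq_eqVlt => /orP [/eqP ->|]; first by rewrite ltnn.
  by rewrite ltnS => ik; rewrite ik; apply: ZW.
split=> i ik; case: ifP => // ik'; first exact: irrZ.
- by move=> x /(ZY' i ik') [/ZkY].
- rewrite ltnS in ik; case: ifP => [ik2|/negbT]; first exact: Zlt.
  rewrite -leqNgt => ki; have {ik ki ik'}-> : i = k by apply/eqP; rewrite eqn_leq ik.
  split; first by move=> x /(ZY' k (leqnn k)) [].
  have [_ [y [Wy nWy]]] := Wlt k (ltnSn k).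
  have /ZkW [x Zx xy] := Wy; exists x; split=> // Zkx; apply: nWy.
  by apply/(ZW k (leqnn k)); exists x.
- by rewrite ltnS ik' in ik.
Qed.

(** If two consecutive images coincided, [Z i.+1] would be covered by the sign translates of [Z i]
    and so lie in a single one. *)
Lemma sqim_irr_chain k (Z : nat -> ptset K I) X :
  irr_chain X k Z -> irr_chain (sqim X) k (fun i => sqim (Z i)).
Proof.
move=> [irrZ ZX Zlt]; split=> i ik; first exact/irreducible_sqim/irrZ.
  by move=> _ [x /(ZX i ik) Xx <-]; exists x.
have [sZ [z [Zz nZz]]] := Zlt i ik; split.
  by move=> _ [x Zx <-]; exists x => //; apply: sZ.
apply: boolp.contrapT => /boolp.forallNP H.
have [cZi _ _] := irrZ i (ltnW ik).
have [g||g sg] := @irreducible_cover _ _ (Z i.+1) _ (enum {ffun I -> bool})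
  (fun g x => Z i (sgn g x)) (irrZ _ ik).
- by apply: closed_preim cZi => j; apply: polyfun_sgn.
- move=> x Zx; have /boolp.not_andP [|/boolp.contrapT] := H (sqp x).
    by case; exists x.
  move=> [x' Zx' /esym /sqp_fiber [g xg]]; exists g; first by rewrite mem_enum.
  by rewrite -xg.
(* [sgn g] is an involution, so applying [sg] to [z] and then to [sgn g z] brings [z] back into
   [Z i]. *)
apply: nZz; have := sZ _ (sg z Zz); move=> /sg; by rewrite sgnK.
Qed.

End Squaring.

(** * Algebraic independence along chains *)

(** Vectors of [k] exponents below [t], nested so that the exponent of the last function splits off
    by computation. *)
Fixpoint box (t k : nat) : finType :=
  if k is k'.+1 then ('I_t * box t k')%type else unit.

Fixpoint bmon (A : comNzRingType) (g : nat -> A) t k : box t k -> A :=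
  match k return box t k -> A with
  | 0 => fun=> 1
  | k'.+1 => fun b => g k' ^+ b.1 * bmon g b.2
  end.

Fixpoint bdeg t k : box t k -> nat :=
  match k return box t k -> nat with
  | 0 => fun=> 0%N
  | k'.+1 => fun b => (b.1 + bdeg b.2)%N
  end.

Lemma card_box t k : #|box t k| = (t ^ k)%N.
Proof.
elim: k => [|k IH]; first by rewrite card_unit.
by rewrite [LHS]card_prod card_ord IH expnS.
Qed.

Lemma bdeg_le t k (b : box t k) : (bdeg b <= k * t)%N.
Proof.
elim: k b => [//|k IH] [j b] /=; rewrite mulSn leq_add ?IH //; exact: ltnW.
Qed.

Lemma eq_bmon (A : comNzRingType) (g g' : nat -> A) t k (b : box t k) :
  (forall i, (i < k)%N -> g i = g' i) -> bmon g b = bmon g' b.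
Proof.
elim: k b => [//|k IH] [j b] /= H; rewrite H // IH // => i ik.
by apply: H; apply: ltnW.
Qed.

Lemma bmonZ (A : comNzRingType) (r : A) (g : nat -> A) t k (b : box t k) :
  bmon (fun i => r * g i) b = r ^+ bdeg b * bmon g b.
Proof.
elim: k b => [|k IH] b /=; first by rewrite mulr1.
by rewrite IH exprMn exprD; ring.
Qed.

Lemma meval_bmon (K : fieldType) m (y : 'I_m -> K) (q : nat -> {mpoly K[m]}) t k
    (b : box t k) : meval y (bmon q b) = bmon (fun i => meval y (q i)) b.
Proof.
elim: k b => [|k IH] b /=; first by rewrite meval1.
by rewrite mevalM rmorphXn /= IH.
Qed.

Lemma polyfun_bmon (K : numClosedFieldType) (I : finType) (g : nat -> pt K I -> K) t k
    (b : box t k) :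
  (forall i, polyfun (g i)) -> polyfun (fun x => bmon (fun i => g i x) b).
Proof.
move=> hg; elim: k b => [|k IH] b /=; first exact: polyfun_cst.
by apply: polyfunM => //; apply: polyfunX.
Qed.

(** The new function [h] vanishes on [Z k] but not on [Z k.+1]. A relation on [Z k.+1] is read as a
    polynomial in [h]: irreducibility allows division by the lowest power of [h], and on [Z k] only
    the lowest coefficient is left, which is zero by independence of the earlier functions. *)
Lemma irr_chain_indep (K : numClosedFieldType) (I : finType) (X : ptset K I) k Z :
  irr_chain X k Z ->
  exists2 g : nat -> pt K I -> K, (forall i, polyfun (g i)) &
  forall t (v : box t k -> K),
    (forall x, Z k x -> \sum_b v b * bmon (fun i => g i x) b = 0) -> forall b, v b = 0.
Proof.
elim: k => [|k IH] [irrZ ZX Zlt].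
  exists (fun=> fun=> 0) => [i|t v H []]; first exact: polyfun_cst.
  have [_ [z Zz] _] := irrZ 0%N (leqnn _).
  by have := H z Zz; rewrite (big_pred1 tt) ?mulr1 //; case.
have [|g hg gind] := IH.
  by split=> i ik; [apply: irrZ|apply: ZX|apply: Zlt]; apply: leqW.
have [sZ [z [Zz nZz]]] := Zlt k (ltnSn k).
have [ck _ _] := irrZ k (leqnSn k).
have [h hh [h0 hz]] := closed_cut ck nZz.
pose g' i := if (i < k)%N then g i else h.
exists g' => [i|t v H]; first by rewrite /g'; case: ifP.
pose w (j : 'I_t) x := \sum_(b : box t k) v (j, b) * bmon (fun i => g i x) b.
have hw j : polyfun (w j).
  by apply: polyfun_sum => b; apply: polyfunM; [apply: polyfun_cst|apply: polyfun_bmon].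
have {}H x : Z k.+1 x -> \sum_(j < t) h x ^+ j * w j x = 0.
  move=> Zx; rewrite -[RHS](H x Zx).
  under eq_bigr do rewrite /w big_distrr /=.
  rewrite pair_big; apply: eq_bigr => -[j b] _ /=.
  rewrite /g' ltnn -/g' (@eq_bmon _ (fun i => g' i x) (fun i => g i x)); first by ring.
  by move=> i ik; rewrite /g' ik.
suff v0 m (j : 'I_t) : (j < m)%N -> forall b, v (j, b) = 0.
  by case=> j b; apply: (v0 t).
elim: m j => [//|m IHm] j; rewrite ltnS leq_eqVlt => /orP [/eqP jm|]; last exact: IHm.
apply: gind => x Zx; rewrite -/(w j x).
pose F x := \sum_(i < t | (m <= i)%N) h x ^+ (i - m) * w i x.
have hF : polyfun F by apply: polyfun_sum => i; apply: polyfunM => //; apply: polyfunX.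
have [||F0] := irreducible_prime (irrZ _ (leqnn _)) (polyfunX m hh) hF.
- move=> y Zy; rewrite -[RHS](H y Zy) big_distrr /=.
  rewrite [RHS](bigID (fun i : 'I_t => (m <= i)%N)) /= [X in _ + X]big1.
    rewrite addr0; apply: eq_bigr => i mi.
    by rewrite mulrA -exprD subnKC.
  move=> i; rewrite -ltnNge => im; rewrite /w big1 ?mulr0 // => b _.
  by rewrite IHm // mul0r.
- by move=> /(_ z Zz) /eqP; rewrite expf_eq0 => /andP [_ /eqP].
have := F0 x (sZ _ Zx); rewrite /F (bigD1 j) ?jm //= subnn mul1r.
rewrite big1 ?addr0 // => i /andP [mi ij]; rewrite h0 // expr0n.
rewrite subn_eq0; case: leqP => [im|_]; last by rewrite mul0r.
by case/eqP: ij; apply/val_inj/eqP; rewrite /= jm eqn_leq im.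
Qed.

(** * Algebraic dependence by counting monomials *)

Lemma exists_left_kernel (K : fieldType) (I J : finType) (M : I -> J -> K) :
  (#|J| < #|I|)%N ->
  exists2 v : I -> K, exists i, v i != 0 & forall j, \sum_i v i * M i j = 0.
Proof.
move=> JI; pose A := \matrix_(i < #|I|, j < #|J|) M (enum_val i) (enum_val j).
have /rowV0Pn [u uA u0] : kermx A != 0.
  rewrite -mxrank_eq0 mxrank_ker subn_eq0 -ltnNge.
  exact: leq_ltn_trans (rank_leq_col _) JI.
exists (fun i => u 0 (enum_rank i)).
  have [i ui] : exists i, u 0 i != 0.
    apply/existsP; apply: contraR u0; rewrite negb_exists => /forallP H.
    by apply/eqP/rowP => i; rewrite mxE; apply/eqP; have := H i; rewrite negbK.
  by exists (enum_val i); rewrite enum_valK.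
move=> j; have /matrixP/(_ 0 (enum_rank j)) := sub_kermxP uA.
rewrite !mxE => e; rewrite -[RHS]e (reindex (fun i : 'I_#|I| => enum_val i)) /=; last first.
  by exists enum_rank => i _; rewrite ?enum_valK ?enum_rankK.
by apply: eq_bigr => i _; rewrite !mxE !enum_rankK enum_valK.
Qed.

Lemma card_bmultinom n B : (#|{: 'X_{1..n < B.+1}}| <= B.+1 ^ n)%N.
Proof.
have -> : (B.+1 ^ n)%N = #|{: {ffun 'I_n -> 'I_B.+1}}|.
  by rewrite card_ffun !card_ord.
pose f (m : 'X_{1..n < B.+1}) : {ffun 'I_n -> 'I_B.+1} := [ffun i => inord (m i)].
apply: (@leq_card _ _ f) => m1 m2 /ffunP e; apply/val_inj/mnmP => i /=.
have b (m : 'X_{1..n < B.+1}) : (m i < B.+1)%N.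
  apply: leq_ltn_trans (bmdeg m); rewrite mdegE (bigD1 i) //=; exact: leq_addr.
by have := congr1 val (e i); rewrite !ffunE /= !inordK.
Qed.

Lemma msizeM_deg (K : fieldType) n (p q : {mpoly K[n]}) a b :
  (msize p <= a.+1)%N -> (msize q <= b.+1)%N -> (msize (p * q) <= (a + b).+1)%N.
Proof.
have [->|p0] := eqVneq p 0; first by rewrite mul0r msize0.
have [->|q0] := eqVneq q 0; first by rewrite mulr0 msize0.
move=> ha hb; rewrite msizeM // -subn1 leq_subLR add1n -addnS -addSn.
exact: leq_add.
Qed.

Lemma msizeX_deg (K : fieldType) n (p : {mpoly K[n]}) a k :
  (msize p <= a.+1)%N -> (msize (p ^+ k) <= (a * k).+1)%N.
Proof.
move=> ha; elim: k => [|k IH]; first by rewrite expr0 msize1.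
by rewrite exprS mulnS; apply: msizeM_deg.
Qed.

(* There are [t ^ n.+1] monomials in the box, but only [O(t ^ n)] monomials of
   degree linear in [t] in [n] variables. *)
Lemma box_dependence (K : fieldType) n (q : nat -> {mpoly K[n]}) (r : {mpoly K[n]}) :
  exists t (v : box t n.+1 -> K), (exists b, v b != 0) /\
    \sum_b v b *: (bmon q b * r ^+ (n.+1 * t - bdeg b)) = 0.
Proof.
(* [e] bounds all degrees. The number of linear equations is at most
   [(e * T).+1 ^ n <= (c * t) ^ n], which is less than the number [t ^ n.+1] of unknowns because
   [c ^ n < t]. *)
pose e := (\max_(i < n.+1) msize (q i) + msize r)%N.
pose c := (e * n.+1).+1; pose t := (c ^ n).+1; pose T := (n.+1 * t)%N.
have hq i : (i < n.+1)%N -> (msize (q i) <= e.+1)%N.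
  move=> ik; apply: leqW; apply: leq_trans (leq_addr _ _).
  exact: (@leq_bigmax _ (fun i : 'I_n.+1 => msize (q i)) (Ordinal ik)).
have hr : (msize r <= e.+1)%N by apply: leqW; apply: leq_addl.
have hb k (b : box t k) : (k <= n.+1)%N -> (msize (bmon q b) <= (e * bdeg b).+1)%N.
  elim: k b => [|k IH] b kn /=; first by rewrite msize1.
  rewrite mulnDr; apply: msizeM_deg; last by apply: IH; apply: ltnW.
  exact/msizeX_deg/hq.
have hp (b : box t n.+1) : (msize (bmon q b * r ^+ (T - bdeg b)) <= (e * T).+1)%N.
  have TE : T = (bdeg b + (T - bdeg b))%N by rewrite subnKC // bdeg_le.
  rewrite {2}TE mulnDr; apply: msizeM_deg; first exact: hb.
  exact: msizeX_deg.
have [|v v0 hv] := @exists_left_kernel K (box t n.+1) {: 'X_{1..n < (e * T).+1}}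
    (fun b m => (bmon q b * r ^+ (T - bdeg b))@_m).
  apply: leq_ltn_trans (card_bmultinom _ _) _; rewrite card_box.
  apply: (@leq_ltn_trans ((c * t) ^ n)).
    by case: (n) => [//|n']; rewrite leq_exp2r // /c /T; nia.
  by rewrite expnMn expnS ltn_pmul2r ?expn_gt0.
exists t, v; split=> //; apply/mpolyP => m; rewrite mcoeff0 raddf_sum /=.
have [mT|mT] := ltnP (mdeg m) (e * T).+1.
  rewrite -[RHS](hv (BMultinom mT)); apply: eq_bigr => b _.
  by rewrite mcoeffZ.
rewrite big1 // => b _; rewrite mcoeffZ memN_msupp_eq0 ?mulr0 //.
by apply: msize_mdeg_ge; apply: leq_trans mT; apply: hp.
Qed.

(** For the quotients [g i = q i / r]: the power of [r] in each term makes all terms carry the same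
    denominator. *)
Lemma box_dependence_quot (K : fieldType) n (q : nat -> {mpoly K[n]}) (r : {mpoly K[n]}) :
  exists t (v : box t n.+1 -> K), (exists b, v b != 0) /\
    forall (y : 'I_n -> K) (g : nat -> K),
      (forall i, (i < n.+1)%N -> meval y (q i) = meval y r * g i) ->
      meval y r ^+ (n.+1 * t) * (\sum_b v b * bmon g b) = 0.
Proof.
have [t [v [vb v0]]] := box_dependence q r; exists t, v; split=> // y g H.
have e := congr1 (meval y) v0; rewrite meval0 in e.
rewrite -[RHS]e raddf_sum big_distrr.
apply: eq_bigr => b _; rewrite [RHS]mevalZ mevalM meval_bmon rmorphXn.
rewrite (eq_bmon _ H) bmonZ.
have TE : (n.+1 * t = bdeg b + (n.+1 * t - bdeg b))%N by rewrite subnKC // bdeg_le.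
rewrite -[LHS]/(meval y r ^+ (n.+1 * t) * (v b * bmon g b)).
by move: (n.+1 * t - bdeg b)%N TE (bmon g b) => m -> a; rewrite exprD /=; ring.
Qed.

(** * Gram matrices *)

Lemma det_mulmx_lt (K : fieldType) k d (A : 'M[K]_(k, d)) (B : 'M[K]_(d, k)) :
  (d < k)%N -> \det (A *m B) = 0.
Proof.
move=> dk; apply/eqP; apply: contraTT dk; rewrite -unitfE => u.
have {u} : A *m B \in unitmx by [].
by rewrite -row_free_unit -leqNgt => /eqP {1}<-; apply: mulmx_max_rank.
Qed.

(** Polarization on sums of two basis vectors, in characteristic zero. *)
Lemma quadratic_form_eq0 (K : numFieldType) m (G : 'M[K]_m) : G^T = G ->
  (forall v : 'rV_m, v *m G *m v^T = 0) -> G = 0.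
Proof.
move=> sG q0; apply/matrixP => i j; rewrite mxE; apply/eqP.
have Gij k l : ((delta_mx 0 k : 'rV_m) *m G *m (delta_mx 0 l : 'rV_m)^T) 0 0 = G k l.
  by rewrite -rowE trmx_delta -colE !mxE.
have := q0 (delta_mx 0 i + delta_mx 0 j); rewrite linearD /= mulmxDl mulmxDr !mulmxDl.
rewrite !q0 addr0 add0r => /matrixP/(_ 0 0); rewrite mxE !Gij mxE.
rewrite -[in G j i]sG mxE -mulr2n => /eqP.
by rewrite mulrn_eq0.
Qed.

(* Lagrange reduction: split off the square of the linear form [v *m G], for a
   vector [v] on which the quadratic form does not vanish. *)
Lemma sym_factor (K : numClosedFieldType) d m (G : 'M[K]_m) : G^T = G ->
  (\rank G <= d)%N -> exists P : 'M_(m, d), G = P *m P^T.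
Proof.
elim: d G => [|d IH] G sG.
  by rewrite leqn0 mxrank_eq0 => /eqP ->; exists 0; rewrite mul0mx.
have [->|G0 rG] := eqVneq G 0; first by exists 0; rewrite mul0mx.
have [v qv] : exists v : 'rV_m, v *m G *m v^T != 0.
  apply: boolp.contrapT => /boolp.forallNP H; case/eqP: G0.
  by apply: quadratic_form_eq0 => // v; apply/eqP; apply: contraT => /H.
pose c := (v *m G *m v^T) 0 0.
have qc : v *m G *m v^T = c%:M by apply: mx11_scalar.
have c0 : c != 0 by apply: contraNneq qv => c0; rewrite qc c0 raddf0.
have s0 : sqrtC c != 0 by rewrite sqrtC_eq0.
pose w := (sqrtC c)^-1 *: (v *m G); pose G' := G - w^T *m w.
have sG' : G'^T = G' by rewrite /G' linearB /= trmx_mul trmxK sG.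
have wT (A : 'M_(_, m)) : A *m w^T = (sqrtC c)^-1 *: (A *m G *m v^T) :> 'M_(_, 1).
  by rewrite /w linearZ /= -scalemxAr trmx_mul sG mulmxA.
have vG' : v *m G' = 0.
  rewrite /G' mulmxBr mulmxA wT qc /w -scalemxAl mul_scalar_mx !scalerA.
  rewrite [X in X *: _](_ : _ = 1) ?scale1r ?subrr //.
  by rewrite mulrAC -invfM -expr2 sqrtCK mulVf.
(* The kernel grows by at least [v], so the rank drops. *)
have ker_lt : (kermx G < kermx G')%MS.
  apply/andP; split.
    by apply/sub_kermxP; rewrite /G' mulmxBr mulmxA wT mulmx_ker mul0mx scaler0 mul0mx subr0.
  apply/negP => sub; have /sub_kermxP vG : (v <= kermx G)%MS.
    by apply: submx_trans sub; apply/sub_kermxP.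
  by move: qv; rewrite vG mul0mx eqxx.
have rG' : (\rank G' <= d)%N.
  move: ker_lt; rewrite ltmxErank => /andP [_]; rewrite !mxrank_ker => h.
  have := rank_leq_row G; have := rank_leq_row G'; move: h rG.
  by move: (\rank G) (\rank G') => a b; lia.
have [P PE] := IH _ sG' rG'.
have GE : G = row_mx w^T P *m (row_mx w^T P)^T.
  by rewrite tr_row_mx mul_row_col trmxK -PE /G' addrC subrK.
by exists (row_mx w^T P).
Qed.

(** A maximal choice of independent rows, and then of independent columns among these, gives an
    invertible minor whose size is the rank. *)
Lemma minors_rank (K : fieldType) m d (G : 'M[K]_m) :
  (forall k (f g : 'I_k -> 'I_m), (d < k)%N -> \det (mxsub f g G) = 0) ->
  (\rank G <= d)%N.
Proof.
move=> H; rewrite leqNgt; apply/negP => dr.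
pose f := maxrankfun G; pose C := rowsub f G.
have fC : row_full C^T.
  by rewrite /row_full mxrank_tr; have := maxrowsub_free G; rewrite -/f -/C => /eqP ->.
have := fullrowsub_unit fC; rewrite unitmxE unitfE.
suff -> : rowsub (fullrankfun fC) C^T = (mxsub f (fullrankfun fC) G)^T.
  by rewrite det_tr H // eqxx.
by apply/matrixP => i j; rewrite !mxE.
Qed.

Section Gram.
Variables (K : numClosedFieldType) (n : nat).
Local Notation V := 'I_n.+1.
Local Notation edges := (pairs n.+1).
Implicit Types (x : pt K edges) (i j : V) (e : edges).

Definition dist x i j : K :=
  match insub (i, j) : option edges, insub (j, i) : option edges with
  | Some e, _ => x e
  | _, Some e => x e
  | _, _ => 0
  end.

Lemma dist_lt x i j (ij : (i < j)%N) : dist x i j = x (Sub (i, j) ij : edges).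
Proof. by rewrite /dist insubT. Qed.

Lemma distxx x i : dist x i i = 0.
Proof. by rewrite /dist insubF //= ltnn. Qed.

Lemma distC x i j : dist x i j = dist x j i.
Proof.
have [ij|ji|/val_inj ->] := ltngtP i j; last by [].
  rewrite /dist insubT /= insubF //=; by apply/negbTE; rewrite -leqNgt ltnW.
rewrite /dist insubF /=; last by apply/negbTE; rewrite -leqNgt ltnW.
by rewrite insubT.
Qed.

Lemma dist_edge x e : dist x (val e).1 (val e).2 = x e.
Proof.
by case: e => -[i j] ij /=; rewrite dist_lt.
Qed.

Lemma polyfun_dist i j : polyfun (fun x => dist x i j).
Proof.
rewrite /dist; case: insubP => [e _ _|_]; first exact: polyfun_coord.
case: insubP => [e _ _|_]; [exact: polyfun_coord|exact: polyfun_cst].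
Qed.

Lemma dist_msq d (p : config K d n.+1) i j :
  dist (msq p) i j = \sum_(k < d) (p i k - p j k) ^+ 2.
Proof.
wlog ij : i j / (i <= j)%N.
  move=> H; have [/H //|/ltnW/H] := leqP i j; rewrite distC => ->.
  by apply: eq_bigr => k _; ring.
move: ij; rewrite leq_eqVlt => /orP [/eqP/val_inj ->|ij].
  by rewrite distxx big1 // => k _; rewrite subrr expr0n.
by rewrite dist_lt.
Qed.

(** The law of cosines with vertex [ord0] as origin: for [x = msq p], the bilinear products of the
    vectors from [p ord0]. *)
Definition gram x : 'M[K]_n.+1 :=
  \matrix_(i, j) ((dist x ord0 i + dist x ord0 j - dist x i j) / 2%:R).

Lemma dist_gram x i j : dist x i j = gram x i i + gram x j j - gram x i j *+ 2.
Proof. by rewrite !mxE !distxx -mulr_natl; field. Qed.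

Lemma gram_sym x : (gram x)^T = gram x.
Proof. by apply/matrixP => i j; rewrite !mxE (distC x i j); ring. Qed.

Lemma polyfun_gram i j : polyfun (fun x => gram x i j).
Proof.
apply: (@eq_polyfun _ _ (fun x => (dist x ord0 i + dist x ord0 j - dist x i j) * 2%:R^-1)).
  by move=> x; rewrite mxE.
apply: polyfunM; last exact: polyfun_cst.
by apply: polyfunB; [apply: polyfunD|]; apply: polyfun_dist.
Qed.

Definition cfg_mx d (p : config K d n.+1) : 'M[K]_(n.+1, d) :=
  \matrix_(i, k) (p i k - p ord0 k).

Lemma gram_msq d (p : config K d n.+1) : gram (msq p) = cfg_mx p *m (cfg_mx p)^T.
Proof.
apply/matrixP => i j; rewrite !mxE !dist_msq -big_split -sumrB mulr_suml.
by apply: eq_bigr => k _; rewrite !mxE /=; field.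
Qed.

(** The rows of a symmetric factor of [gram x] form a configuration, and [dist_gram] recovers [x]
    from its Gram matrix. *)
Lemma Mdn_of_rank d x : (\rank (gram x) <= d)%N -> Mdn K d n.+1 x.
Proof.
move=> /(sym_factor (gram_sym x)) [P PE]; exists (fun i k => P i k).
apply: boolp.funext => e; rewrite -dist_edge dist_msq -[RHS]dist_edge dist_gram PE !mxE.
rewrite -sumrMnl -big_split -sumrB; apply: eq_bigr => k _.
by rewrite !mxE -mulr_natl /=; ring.
Qed.

Lemma Mdn_gram d x : Mdn K d n.+1 x -> exists P : 'M_(n.+1, d), gram x = P *m P^T.
Proof. by move=> [p <-]; exists (cfg_mx p); apply: gram_msq. Qed.

(** The equations are the minors of the Gram matrix of size larger than [d]; smaller sizes
    contribute the zero equation. *)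
Lemma closed_Mdn d : zariski_closed (Mdn K d n.+1).
Proof.
pose T := {k : nat & (('I_k -> V) * ('I_k -> V))%type}.
pose F (t : T) x := if (d < tag t)%N then
  \det (mxsub (tagged t).1 (tagged t).2 (gram x)) else 0.
apply: (@eq_closed _ _ (fun x => forall t, F t x = 0)); last first.
  apply: closed_zeros => -[k [f g]]; rewrite /F /=; case: (d < k)%N.
    apply: polyfun_det => i j; apply: eq_polyfun (polyfun_gram (f i) (g j)) => x.
    by rewrite [RHS]mxE.
  exact: polyfun_cst.
move=> x; split=> [H|/Mdn_gram [P PE] [k [f g]]].
  apply: Mdn_of_rank; apply: minors_rank => k f g dk.
  by have := H (existT _ k (f, g)); rewrite /F /= dk.
rewrite /F /=; case: ifP => // dk; rewrite PE mxsub_mul.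
exact: det_mulmx_lt.
Qed.

End Gram.

(** * The squared measurement variety *)

Section MeasurementVariety.
Variables (K : numClosedFieldType) (d n : nat).
Hypothesis dn : (d <= n)%N.
Local Notation V := 'I_n.+1.
Local Notation edges := (pairs n.+1).
Local Notation M := (Mdn K d n.+1).
Implicit Types (x : pt K edges).

Lemma polyfun_msq (J : finType) (p : pt K J -> config K d n.+1) e :
  (forall i k, polyfun (fun y => p y i k)) -> polyfun (fun y => msq (p y) e).
Proof. by move=> hp; apply: polyfun_sum => k; apply/polyfunX/polyfunB. Qed.

Lemma irreducible_Mdn : irreducible M.
Proof.
pose p (y : pt K (V * 'I_d)%type) : config K d n.+1 := fun i k => y (i, k).
apply: eq_irreducible (@irreducible_image K edges _ (fun y => msq (p y)) _) => [x|e].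
  split; last first.
    by move=> [q <-]; apply: sub_zclosure; exists (fun ik => q ik.1 ik.2).
  by apply: zclosure_min; [exact: closed_Mdn|move=> _ [y <-]; exists (p y)].
by apply: polyfun_msq => i k; apply: polyfun_coord.
Qed.

(** A slot [(c, r)] serves twice: as entry [(r, c)] of a lower triangular configuration with vertex
    [0] at the origin, and as the Gram entry of the vertices [c.+1] and [r]. *)
Definition slots : finType := {e : 'I_d * V | (e.1 < e.2)%N}.

Lemma card_slots : #|slots| = (d * n.+1 - 'C(d.+1, 2))%N.
Proof.
have -> : #|slots| = (\sum_(c < d) (n - c))%N.
  rewrite card_sig -sum1_card (eq_bigl (fun e : 'I_d * V => (e.1 < e.2)%N)); last first.
    by move=> e; rewrite unfold_in.
  rewrite -(pair_big_dep xpredT (fun (c : 'I_d) (r : V) => (c < r)%N) (fun _ _ => 1%N)) /=.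
  apply: eq_bigr => c _.
  rewrite -(big_mkord (fun r => (c < r)%N) (fun=> 1%N)).
  have cn : (c.+1 <= n.+1)%N by rewrite ltnS (leq_trans (ltnW (ltn_ord c))).
  rewrite (big_cat_nat (leq0n c.+1) cn) /= big_nat_cond big_pred0 => [|r]; last first.
    by rewrite ltnS; case: leqP.
  rewrite add0n big_nat_cond (eq_bigl (fun r => (c < r < n.+1)%N)) => [|r]; last first.
    by case: (c < r)%N; rewrite ?andbF ?andbT.
  by rewrite -big_nat sum_nat_const_nat muln1 subSS.
suff H m : (m <= n)%N -> (\sum_(c < m) (n - c) + 'C(m.+1, 2) = m * n.+1)%N.
  by rewrite -(H d dn) addnK.
elim: m => [|m IH] mn; first by rewrite big_ord0.
rewrite big_ord_recr /= binS bin1 mulSn -IH ?(ltnW mn) //.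
by move: (\sum_(i < m) _)%N 'C(_, _) => a b; lia.
Qed.

Definition vtx (c : 'I_d) : V := inord c.+1.

Lemma val_vtx c : vtx c = c.+1 :> nat.
Proof. by rewrite /vtx inordK // ltnS (leq_trans (ltn_ord c)). Qed.

Definition gcoord x : pt K slots := fun e => gram x (vtx (val e).1) (val e).2.

Lemma gram0r x i : gram x i ord0 = 0.
Proof. by rewrite mxE distxx addr0 distC subrr mul0r. Qed.

Lemma gram_coord c r : exists2 q : pt K slots -> K, polyfun q &
  forall x, gram x (vtx c) r = q (gcoord x).
Proof.
have [cr|] := ltnP c r.
  pose e : slots := Sub (c, r) cr.
  by exists (fun y => y e) => //; apply: polyfun_coord.
case: (posnP r) => [r0 _|r0 rc].
  exists (fun=> 0) => [|x]; first exact: polyfun_cst.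
  by rewrite (_ : r = ord0) ?gram0r //; apply: val_inj.
(* By symmetry, as [r] is itself the vertex of [r.-1], the entry is that of the slot
   [(r.-1, vtx c)]. *)
have rd : (r.-1 < d)%N by have := ltn_ord c; lia.
have h : (Ordinal rd < vtx c)%N by rewrite val_vtx /=; lia.
pose e : slots := Sub (Ordinal rd, vtx c) h.
exists (fun y => y e) => [|x]; first exact: polyfun_coord.
rewrite /gcoord /= -[in LHS]gram_sym mxE; congr (gram x _ _).
by apply: val_inj; rewrite /= val_vtx /= prednK.
Qed.

Definition gblock x : 'M[K]_d := mxsub vtx vtx (gram x).
Definition gdet x : K := \det (gblock x).

Lemma polyfun_gdet : polyfun gdet.
Proof.
apply: polyfun_det => i j; apply: eq_polyfun (polyfun_gram K (vtx i) (vtx j)) => x.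
by rewrite [RHS]mxE.
Qed.

Lemma gdet_coord : exists2 q : pt K slots -> K, polyfun q & forall x, gdet x = q (gcoord x).
Proof.
have /boolp.choice [q hq] (cr : 'I_d * V) : exists q : pt K slots -> K,
    polyfun q /\ forall x, gram x (vtx cr.1) cr.2 = q (gcoord x).
  by have [q] := gram_coord cr.1 cr.2; exists q.
exists (fun y => \det (\matrix_(a, b) q (a, vtx b) y)).
  apply: polyfun_det => a b; apply: eq_polyfun (proj1 (hq (a, vtx b))) => y.
  by rewrite mxE.
move=> x; congr (\det _); apply/matrixP => a b.
by rewrite [RHS]mxE [LHS]mxE; have [_ <-] := hq (a, vtx b).
Qed.

(* Where the [d x d] block is invertible, a Gram matrix of rank [d] is determined
   by its rows indexed by [vtx]. *)
Lemma gram_bordered i j : exists2 q : pt K slots -> K, polyfun q &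
  forall x, M x -> gdet x != 0 -> gdet x * gram x i j = q (gcoord x).
Proof.
have /boolp.choice [q hq] (cr : 'I_d * V) : exists q : pt K slots -> K,
    polyfun q /\ forall x, gram x (vtx cr.1) cr.2 = q (gcoord x).
  by have [q] := gram_coord cr.1 cr.2; exists q.
pose Q y := \matrix_(a, b) q (a, vtx b) y.
exists (fun y => \sum_b (\sum_a q (a, i) y * (\adj (Q y)) a b) * q (b, j) y).
  apply: polyfun_sum => b; apply: polyfunM; last by have [] := hq (b, j).
  apply: polyfun_sum => a; apply: polyfunM; first by have [] := hq (a, i).
  apply: polyfun_adj => a' b'; apply: eq_polyfun (proj1 (hq (a', vtx b'))) => y.
  by rewrite mxE.
move=> x Mx; have [P PE] := Mdn_gram Mx.
have QE : Q (gcoord x) = gblock x.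
  by apply/matrixP => a b; rewrite [LHS]mxE [RHS]mxE; have [_ <-] := hq (a, vtx b).
pose P1 := rowsub vtx P.
have gE : gblock x = P1 *m P1^T.
  by rewrite /gblock PE mxsub_mul; congr (_ *m _); apply/matrixP => a b; rewrite !mxE.
rewrite /gdet => D0.
have P1u : P1 \in unitmx.
  by move: D0; rewrite unitmxE unitfE gE det_mulmx mulf_eq0 negb_or => /andP [].
have P1tu : P1^T \in unitmx by rewrite unitmx_tr.
(* Multiplied by [P1] on the left and [P1^T] on the right, the left side becomes
   [gblock x *m \adj (gblock x) *m gblock x]. *)
have key : P1^T *m \adj (gblock x) *m P1 = (\det (gblock x))%:M.
  apply: (can_inj (mulKmx P1u)); apply: (can_inj (mulmxK P1tu)).
  by rewrite !mulmxA -gE mul_mx_adj scalar_mxC.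
transitivity ((P *m (P1^T *m \adj (gblock x) *m P1) *m P^T) i j).
  by rewrite key mul_mx_scalar -scalemxAl -PE [RHS]mxE.
rewrite !mulmxA -mulmxA mxE; apply: eq_bigr => b _; congr (_ * _); last first.
  have [_ <-] := hq (b, j); rewrite PE [RHS]mxE [LHS]mxE.
  by apply: eq_bigr => k _; rewrite !mxE.
rewrite mxE QE; apply: eq_bigr => a _; congr (_ * _).
have [_ <-] := hq (a, i); rewrite PE [RHS]mxE [LHS]mxE.
by apply: eq_bigr => k _; rewrite !mxE mulrC.
Qed.

(** On [M], [F] is a rational function of the slot coordinates with denominator [gdet ^+ u]. *)
Definition tame u (F : pt K edges -> K) := exists2 q : pt K slots -> K, polyfun q &
  forall x, M x -> gdet x != 0 -> gdet x ^+ u * F x = q (gcoord x).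

Lemma tameW u u' F : (u <= u')%N -> tame u F -> tame u' F.
Proof.
move=> uu' [q hq qF]; have [D hD DE] := gdet_coord.
exists (fun y => D y ^+ (u' - u) * q y); first by apply: polyfunM => //; apply: polyfunX.
by move=> x Mx Dx; rewrite -qF // -DE mulrA -exprD subnK.
Qed.

Lemma polyfun_tame F : polyfun F -> exists u, tame u F.
Proof.
move: F; apply: (@polyfun_ind K edges (fun F => exists u, tame u F)).
- move=> c; exists 0%N, (fun=> c) => [|x _ _]; first exact: polyfun_cst.
  by rewrite mul1r.
- move=> e; set i := (val e).1; set j := (val e).2.
  have [qii hii qiiE] := gram_bordered i i; have [qjj hjj qjjE] := gram_bordered j j.
  have [qij hij qijE] := gram_bordered i j.
  exists 1%N, (fun y => qii y + qjj y - (qij y + qij y)).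
    by apply: polyfunB; apply: polyfunD.
  move=> x Mx Dx; rewrite -qiiE // -qjjE // -qijE // -dist_edge dist_gram -/i -/j.
  by ring.
- move=> F G [u [q hq qF]] [u' [q' hq' qG]]; have [D hD DE] := gdet_coord.
  exists (u + u')%N, (fun y => D y ^+ u' * q y + D y ^+ u * q' y).
    by apply: polyfunD; apply: polyfunM => //; apply: polyfunX.
  by move=> x Mx Dx; rewrite -qF // -qG // -DE exprD; ring.
- move=> F G [u [q hq qF]] [u' [q' hq' qG]].
  exists (u + u')%N, (fun y => q y * q' y); first exact: polyfunM.
  by move=> x Mx Dx; rewrite -qF // -qG // exprD; ring.
Qed.

Lemma gdet_neq0 : exists2 x, M x & gdet x != 0.
Proof.
(* Vertex [c.+1] at the basis vector [c], all others at the origin: the block is the identity. *)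
pose p : config K d n.+1 := fun r c => ((r : nat) == c.+1)%:R.
exists (msq p); first by exists p.
rewrite /gdet /gblock gram_msq mxsub_mul (_ : _ *m _ = 1%:M) ?det1 ?oner_eq0 //.
suff -> : rowsub vtx (cfg_mx p) = 1%:M.
  rewrite mul1mx (_ : colsub _ _ = 1%:M) //.
  apply/matrixP => i j; rewrite !mxE /p val_vtx // eqSS subr0 eq_sym.
  by [].
apply/matrixP => i j; rewrite !mxE /p val_vtx // eqSS subr0.
by [].
Qed.

(** Such a chain gives [#|slots|.+1] independent functions. Over a common power of [gdet] they are
    polynomials in [#|slots|] coordinates, so they satisfy a relation where [gdet] is nonzero;
    irreducibility of [M] extends it to all of [M]. *)
Lemma Mdn_no_chain : ~ exists Z, irr_chain M #|slots|.+1 Z.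
Proof.
move=> [Z cZ]; have [g hg gind] := irr_chain_indep cZ.
set k := #|slots| in cZ g hg gind *.
have [u hu] : exists u, forall i, (i < k.+1)%N -> tame u (g i).
  elim: k.+1 => [|m [u hu]]; first by exists 0%N.
  have [u' hu'] := polyfun_tame (hg m).
  exists (maxn u u') => i; rewrite ltnS leq_eqVlt => /orP [/eqP ->|im].
    by apply: tameW hu'; apply: leq_maxr.
  by apply: tameW (hu i im); apply: leq_maxl.
have /boolp.choice [q hq] i : exists q : {mpoly K[#|slots|]}, (i < k.+1)%N ->
    forall x, M x -> gdet x != 0 -> gdet x ^+ u * g i x = peval q (gcoord x).
  case: (ltnP i k.+1) => [/hu [h [q qh] hE]|_]; last by exists 0.
  by exists q => _ x Mx Dx; rewrite hE // qh.
have [D [r rD] DE] := gdet_coord.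
have [t [v [[b vb] v0]]] := box_dependence_quot q (r ^+ u).
case/eqP: vb; apply: gind => x Zx {b}.
pose F x := \sum_(b : box t k.+1) v b * bmon (fun i => g i x) b.
have [] := @irreducible_prime _ _ M gdet F irreducible_Mdn polyfun_gdet.
- apply: polyfun_sum => b; apply: polyfunM; first exact: polyfun_cst.
  exact: polyfun_bmon.
- move=> {Zx}x Mx; have [->|Dx] := eqVneq (gdet x) 0; first by rewrite mul0r.
  have ru : meval (fun i => gcoord x (enum_val i)) (r ^+ u) = gdet x ^+ u.
    by rewrite rmorphXn /= DE -rD.
  have F0 := v0 (fun i => gcoord x (enum_val i)) (fun i => g i x) _.
  have {F0} /eqP := F0 (fun i ik => etrans (esym (hq i ik x Mx Dx))
    (esym (congr1 ( *%R^~ _) ru))).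
  rewrite ru mulf_eq0 !expf_eq0 (negbTE Dx) !andbF orFb => /eqP h.
  by rewrite (h : F x = 0) mulr0.
- by have [y My /eqP] := gdet_neq0 => Dy /(_ y My).
- by apply; case: cZ => _ /(_ k.+1 (leqnn _)) + _; apply.
Qed.

(** The order in which entries are freed: row by row, from left to right. *)
Definition slot_key (e : slots) := ((val e).2 * d + (val e).1)%N.

Lemma slot_key_inj : injective slot_key.
Proof.
move=> [[c r] cr] [[c' r'] cr']; rewrite /slot_key /= => e.
have d0 : (0 < d)%N by case: (d) c {cr e} => [[]|].
apply: val_inj => /=; congr (_, _); apply: val_inj => /=.
  by have := congr1 (fun m => m %% d)%N e; rewrite !modnMDl !modn_small.
by have := congr1 (fun m => m %/ d)%N e; rewrite !divnMDl // !divn_small // !addn0.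
Qed.

Definition tri_cfg th (a : pt K slots) : config K d n.+1 := fun r c =>
  if insub (c, r) : option slots is Some e then if (slot_key e < th)%N then a e else 0 else 0.

Definition tri_locus th : ptset K edges :=
  zclosure (fun x => exists a, msq (tri_cfg th a) = x).

Lemma irreducible_tri_locus th : irreducible (tri_locus th).
Proof.
apply: irreducible_image => e; apply: polyfun_msq => r c; rewrite /tri_cfg.
case: insubP => [s _ _|_]; last exact: polyfun_cst.
by case: (_ < _)%N; [exact: polyfun_coord|exact: polyfun_cst].
Qed.

Lemma tri_locus_sub th : subset (tri_locus th) M.
Proof. by apply: zclosure_min; [exact: closed_Mdn|move=> _ [a <-]; eexists]. Qed.

Lemma tri_locus_mono th th' : (th <= th')%N -> subset (tri_locus th) (tri_locus th').
Proof.
move=> le; apply: zclosure_min; first exact: closed_zclosure.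
move=> _ [a <-]; apply: sub_zclosure.
exists (fun e => if (slot_key e < th)%N then a e else 0); congr msq.
apply: boolp.funext => r; apply: boolp.funext => c; rewrite /tri_cfg.
case: insubP => // e _ _; case: (ltnP (slot_key e) th) => h; rewrite ?if_same //.
by rewrite (leq_trans h le).
Qed.

Lemma gram_tri th a : gram (msq (tri_cfg th a)) =
  (\matrix_(r, c) tri_cfg th a r c) *m (\matrix_(r, c) tri_cfg th a r c)^T.
Proof.
rewrite gram_msq; suff -> : cfg_mx (tri_cfg th a) = \matrix_(r, c) tri_cfg th a r c by [].
apply/matrixP => r c; rewrite !mxE [X in _ - X](_ : _ = 0) ?subr0 //.
by rewrite /tri_cfg insubF //= ltn0.
Qed.

(* The principal Gram minor on the vertices [1 .. c] and [r], where [(c, r)] is the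
   slot [e], vanishes exactly as long as the slot [e] stays empty. *)
Lemma tri_locus_proper th th' (e : slots) : (th <= slot_key e < th')%N ->
  psubset (tri_locus th) (tri_locus th').
Proof.
move=> /andP [the eth']; split; first by apply: tri_locus_mono; lia.
have [c cE] : exists c, c = (val e).1 by eexists.
have [r rE] : exists r, r = (val e).2 by eexists.
have cr : (c < r)%N by rewrite cE rE; case: (e).
have keyE : slot_key e = (r * d + c)%N by rewrite /slot_key cE rE.
have cd := ltn_ord c.
pose f (i : 'I_c.+1) : V := if (i < c)%N then inord i.+1 else r.
have fE i : f i = (if (i < c)%N then i.+1 else r) :> nat.
  rewrite /f; case: ifP => // ic; rewrite inordK // ltnS; lia.
have fr i : (f i <= r)%N by rewrite fE; case: ifP; lia.
pose B th a : 'M[K]_(c.+1, d) := rowsub f (\matrix_(r, c) tri_cfg th a r c).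
have minorE th0 a : \det (mxsub f f (gram (msq (tri_cfg th0 a)))) =
    \det (B th0 a *m (B th0 a)^T).
  rewrite gram_tri mxsub_mul; congr (\det (_ *m _)).
  by apply/matrixP => i j; rewrite !mxE.
pose F x := \det (mxsub f f (gram x)).
have hF : polyfun F.
  apply: polyfun_det => i j; apply: eq_polyfun (polyfun_gram K (f i) (f j)) => x.
  by rewrite [RHS]mxE.
(* Ones in the columns up to [c] and zeros beyond, so that the chosen rows form the unitriangular
   matrix [L] below, padded by zero columns. *)
pose a (s : slots) : K := ((val s).1 <= c)%N%:R.
exists (msq (tri_cfg th' a)); split; first by apply: sub_zclosure; exists a.
move=> /(_ F hF) F0.
have {F0} /eqP : F (msq (tri_cfg th' a)) = 0.
  apply: F0 => _ [a' <-]; rewrite /F minorE.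
  (* The columns from [c] on vanish: in rows [1 .. c] by triangularity, in row [r] because their
     keys are at least [th]. So the minor of size [c.+1] factors through [c] columns. *)
  have -> : B th a' = B th a' *m (pid_mx c : 'M_(d, c)) *m (pid_mx c : 'M_(c, d)).
    rewrite -mulmxA mul_pid_mx !minnn; apply/matrixP => i k.
    rewrite [RHS]mxE (bigD1 k) //= big1 ?addr0 => [|l lk]; last first.
      by rewrite [pid_mx _ _ _]mxE val_eqE (negbTE lk) mulr0.
    rewrite [pid_mx _ _ _]mxE eqxx /=; case: ltnP => [_|ck]; first by rewrite mulr1.
    rewrite mulr0 !mxE /tri_cfg; case: insubP => // s _ sE.
    rewrite ifF //; apply/negbTE; rewrite -leqNgt (leq_trans the) // keyE /slot_key sE /=.
    have := valP s; rewrite sE /= fE.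
    by case: (ltnP i c) => ic kf; [lia|rewrite leq_add2l].
  by rewrite -mulmxA det_mulmx_lt.
rewrite /F minorE; pose L : 'M[K]_c.+1 := \matrix_(i, j) (j <= i)%N%:R.
have -> : B th' a = L *m (pid_mx c.+1 : 'M_(c.+1, d)).
  apply/matrixP => i k; transitivity ((k <= i)%N%:R : K); last first.
    rewrite [RHS]mxE; have [kc|ck] := ltnP k c.+1.
      rewrite (bigD1 (Ordinal kc)) //= big1 ?addr0 => [|l lk]; last first.
        by rewrite [pid_mx _ _ _]mxE -(inj_eq val_inj) /= in lk *; rewrite (negbTE lk) mulr0.
      by rewrite [pid_mx _ _ _]mxE eqxx kc /= mulr1 mxE.
    rewrite big1 => [|l _]; last first.
      by rewrite [pid_mx _ _ _]mxE (ltn_eqF (leq_trans (ltn_ord l) ck)) mulr0.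
    by rewrite leqNgt (leq_trans (ltn_ord i) ck).
  rewrite !mxE /tri_cfg; case: insubP => [s kf sE|kf]; rewrite /= in kf.
    rewrite /a /slot_key sE /=; have := ltn_ord i; have := ltn_ord k; move: kf.
    rewrite fE; case: (ltnP i c) => ic kf kd ic'.
      have -> : (i.+1 * d + k < th')%N by nia.
      by congr ((nat_of_bool _)%:R); lia.
    case: (leqP k c) => kc; last first.
      by rewrite if_same (_ : (k <= i)%N = false) //; lia.
    have -> : (r * d + k < th')%N by lia.
    by congr ((nat_of_bool _)%:R); lia.
  rewrite (_ : (k <= i)%N = false) //; move: kf; rewrite fE.
  by have := ltn_ord i; case: (ltnP i c); lia.
rewrite trmx_mul tr_pid_mx mulmxA -(mulmxA L) mul_pid_mx (minn_idPr _) ?minnn //.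
rewrite pid_mx_1 mulmx1 det_mulmx det_tr.
have -> : \det L = 1; last by rewrite mulr1 oner_eq0.
rewrite det_trig; first by rewrite big1 // => i _; rewrite mxE leqnn.
by apply/is_trig_mxP => i j ij; rewrite mxE leqNgt ij.
Qed.

Lemma Mdn_chain : exists Z, irr_chain M #|slots| Z.
Proof.
pose s := sort leq [seq slot_key e | e <- enum slots].
have ss : size s = #|slots| by rewrite size_sort size_map -cardE.
have s_lt : sorted ltn s.
  rewrite ltn_sorted_uniq_leq sort_uniq sort_sorted ?andbT; last exact: leq_total.
  by rewrite map_inj_uniq ?enum_uniq //; apply: slot_key_inj.
have s_key k : (k < #|slots|)%N -> exists e, slot_key e = nth 0%N s k.
  rewrite -ss => /(mem_nth 0%N); rewrite mem_sort => /mapP [e _ ->].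
  by exists e.
have key_lt e : (slot_key e < n.+1 * d)%N.
  by have := ltn_ord (val e).1; have := ltn_ord (val e).2; rewrite /slot_key; nia.
(* The sorted keys are the thresholds, so the locus of index [k] has [k] free entries; the default
   [n.+1 * d] exceeds all keys and serves the last index. *)
exists (fun k => tri_locus (nth (n.+1 * d)%N s k)); split=> i ik.
- exact: irreducible_tri_locus.
- exact: tri_locus_sub.
have [e eE] := s_key i ik; apply: (@tri_locus_proper _ _ e).
rewrite (set_nth_default 0%N) ?ss // -eE leqnn /=.
have [iS|iS] := ltnP i.+1 #|slots|; last by rewrite nth_default ?ss.
rewrite (set_nth_default 0%N) ?ss // eE.
by rewrite (sorted_ltn_nth ltn_trans) ?inE ?ss.
Qed.

End MeasurementVariety.

(** * Products of squared lengths are not squares *)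

Section Nonsquare.
Variables (K : numClosedFieldType) (d n : nat).
Local Notation V := 'I_n.+1.
Local Notation edges := (pairs n.+1).
Local Notation coords := (V * 'I_d.+2)%type.

Definition cfg_of (y : pt K coords) : config K d.+2 n.+1 := fun i k => y (i, k).

(** Isotropic for [a = 'i] and [a = - 'i], a unit vector for [a = 0]. *)
Definition isovec (a : K) (k : 'I_d.+2) : K :=
  if k == 0 :> nat then 1 else if k == 1%N :> nat then a else 0.

Lemma sum_first2 (F : 'I_d.+2 -> K) : (forall k : 'I_d.+2, (1 < k)%N -> F k = 0) ->
  \sum_k F k = F 0 + F 1.
Proof.
move=> H; rewrite !big_ord_recl big1 ?addr0 => [|k _]; last by apply: H.
by congr (F _ + F _); apply: val_inj.
Qed.

Lemma isovec_sqr : \sum_k isovec 'i k ^+ 2 = 0.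
Proof.
rewrite sum_first2 => [|k k1]; first by rewrite /isovec /= sqrCi expr1n subrr.
by rewrite /isovec; case: (nat_of_ord k) k1 => [|[]] // m _; rewrite expr0n.
Qed.

Definition push (i0 : V) (ik : coords) : K := if ik.1 == i0 then isovec 'i ik.2 else 0.

Definition slope i0 (y : pt K coords) (e : edges) : K :=
  (((val e).1 == i0)%:R - ((val e).2 == i0)%:R) *
  (\sum_k isovec 'i k * (y ((val e).1, k) - y ((val e).2, k))) *+ 2.

(* The direction is isotropic, so squared lengths are affine along the line. *)
Lemma msq_push i0 y t e : msq (cfg_of (fun ik => y ik + t * push i0 ik)) e =
  msq (cfg_of y) e + t * slope i0 y e.
Proof.
rewrite /msq /slope /cfg_of; set i := (val e).1; set j := (val e).2.
set eps := (_%:R - _).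
rewrite (eq_bigr (fun k => (y (i, k) - y (j, k)) ^+ 2 +
  (t * eps *+ 2) * (isovec 'i k * (y (i, k) - y (j, k))) +
  (t * eps) ^+ 2 * isovec 'i k ^+ 2)) => [|k _]; last first.
  have -> : push i0 (i, k) = (i == i0)%:R * isovec 'i k.
    by rewrite /push /=; case: eqP; rewrite ?mul1r ?mul0r.
  have -> : push i0 (j, k) = (j == i0)%:R * isovec 'i k.
    by rewrite /push /=; case: eqP; rewrite ?mul1r ?mul0r.
  by rewrite /eps; ring.
rewrite !big_split /= -!big_distrr /= isovec_sqr mulr0 addr0.
by ring.
Qed.

Lemma polyfun_msq_cfg e : polyfun (fun y => msq (cfg_of y) e).
Proof. by apply: polyfun_msq => i k; apply: polyfun_coord. Qed.

Lemma polyfun_slope i0 e : polyfun (fun y => slope i0 y e).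
Proof.
have h : polyfun (fun y => ((((val e).1 == i0)%:R - ((val e).2 == i0)%:R) *+ 2) *
  (\sum_k isovec 'i k * (y ((val e).1, k) - y ((val e).2, k)))).
  apply: polyfunM; first exact: polyfun_cst.
  apply: polyfun_sum => k; apply: polyfunM; first exact: polyfun_cst.
  by apply: polyfunB; apply: polyfun_coord.
by apply: eq_polyfun h => y; rewrite /slope; ring.
Qed.

(** [j0] sits at an isotropic point whose product with the push direction is nonzero; the extra
    vertex [l] serves to give another edge a nonzero length. *)
Definition witness (j0 l : V) (ik : coords) : K :=
  if ik.1 == j0 then isovec (- 'i) ik.2
  else if ik.1 == l then isovec 0 ik.2 else 0.

Lemma witness_e0 (e0 : edges) l : l != (val e0).1 ->
  msq (cfg_of (witness (val e0).2 l)) e0 = 0 /\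
  slope (val e0).1 (witness (val e0).2 l) e0 != 0.
Proof.
move=> li; have ne : ((val e0).1 == (val e0).2) = false.
  by apply/negbTE; rewrite -val_eqE neq_ltn; case: (e0) => /= ? ->.
have w1 k : witness (val e0).2 l ((val e0).1, k) = 0.
  by rewrite /witness /= ne eq_sym (negbTE li).
have w2 k : witness (val e0).2 l ((val e0).2, k) = isovec (- 'i) k.
  by rewrite /witness /= eqxx.
split.
  rewrite /msq /cfg_of sum_first2 => [|k k1].
    by rewrite !w1 !w2 /isovec /= !sub0r !sqrrN sqrCi expr1n subrr.
  by rewrite w1 w2 /isovec; case: (nat_of_ord k) k1 => [|[]] // m _; rewrite subrr expr0n.
have ne2 : ((val e0).2 == (val e0).1) = false by rewrite eq_sym.
rewrite /slope eqxx ne2 subr0 mul1r sum_first2 => [|k k1]; last first.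
  by rewrite /isovec; case: (nat_of_ord k) k1 => [|[]] // m _; rewrite mul0r.
rewrite !w1 !w2 /isovec /= !sub0r mul1r opprK -expr2 sqrCi.
by rewrite mulrn_eq0 /= -opprD oppr_eq0 -mulr2n mulrn_eq0 /= oner_eq0.
Qed.

(** An edge other than [e0] has an endpoint that is not an end of [e0]. With [l] there, its squared
    length is [1], or [-1] if the other endpoint is [j0]. *)
Lemma witness_e (e0 e : edges) : e != e0 ->
  exists2 l, l != (val e0).1 & msq (cfg_of (witness (val e0).2 l)) e != 0.
Proof.
case: e => -[a b] /= ab ne.
pose i0 := (val e0).1; pose j0 := (val e0).2.
have ij0 : (i0 < j0)%N by rewrite /i0 /j0; case: (e0).
have ijE : val e0 = (i0, j0) by rewrite /i0 /j0; case: (val e0).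
have wl l k : l != j0 -> witness j0 l (l, k) = isovec 0 k.
  by move=> lj; rewrite /witness /= (negbTE lj) eqxx.
have wo l o k : o != l ->
    witness j0 l (o, k) = if o == j0 then isovec (- 'i) k else 0.
  by move=> ol; rewrite /witness /= (negbTE ol).
have isoS (c : K) (k : 'I_d.+2) : (1 < k)%N -> isovec c k = 0.
  by rewrite /isovec; case: (nat_of_ord k) => [|[]].
have sum_neq0 l o : l != j0 -> o != l ->
    \sum_k (witness j0 l (l, k) - witness j0 l (o, k)) ^+ 2 != 0.
  move=> lj ol; rewrite sum_first2 => [|k k1]; last first.
    by rewrite wl // wo // !isoS // if_same subrr expr0n.
  rewrite !wl // !wo // /isovec /=; case: (o == j0).
    by rewrite subrr sub0r opprK sqrCi expr0n add0r oppr_eq0 oner_eq0.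
  by rewrite !subr0 expr1n expr0n addr0 oner_eq0.
have ba : b != a by rewrite -val_eqE neq_ltn ab orbT.
rewrite /msq /cfg_of /=; have [/andP [ai aj]|] := boolP ((a != i0) && (a != j0)).
  by exists a => //; apply: sum_neq0.
move=> a0; have {a0} [bi bj] : b != i0 /\ b != j0.
  have ne' : (a != i0) || (b != j0).
    apply: contraR ne; rewrite negb_or !negbK => /andP [/eqP ai /eqP bj].
    by apply/eqP/val_inj; rewrite /= ijE ai bj.
  by move: a0 ne' (ab) ij0; rewrite -!val_eqE /=; clear; split; lia.
exists b => //; have := sum_neq0 b a bj; rewrite eq_sym => /(_ ba).
by congr (_ != _); apply: eq_bigr => k _; rewrite -sqrrN opprB.
Qed.

(** Along a generic line in the push direction, the factor of [e0] has a simple root [t0] that no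
    other factor shares. If [v] were nonzero, [t0] would have odd multiplicity on the left and even
    multiplicity on the right. *)
Lemma msq_nonsquare (S : seq edges) (e0 : edges) (u v : pt K coords -> K) :
  uniq S -> e0 \in S -> polyfun u -> polyfun v ->
  (forall y, v y ^+ 2 * \prod_(e <- S) msq (cfg_of y) e = u y ^+ 2) ->
  forall y, v y = 0.
Proof.
move=> uS e0S hu hv H y1; apply/eqP; apply: contraT => vy1.
pose i0 := (val e0).1; pose m y e := msq (cfg_of y) e; pose sl := slope i0.
(* Up to the factor [sl y e0], the value of the affine function of [e] at the root of that of
   [e0]. *)
pose cross e y := m y e * sl y e0 - m y e0 * sl y e.
have hm e : polyfun (fun y => m y e) by apply: polyfun_msq_cfg.
have hsl e : polyfun (fun y => sl y e) by apply: polyfun_slope.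
have ne0 : (val e0).2 != (val e0).1.
  by rewrite -val_eqE neq_ltn; case: (e0) => /= ? ->; rewrite orbT.
pose F (o : option edges) y := if o is Some e then cross e y else v y * sl y e0.
have [| |y hy] := @polyfun_common_nonzero K _ _
    (None :: [seq Some e | e <- enum edges & e != e0]) F.
- case=> [e|]; last exact: polyfunM.
  by apply: polyfunB; apply: polyfunM.
- move=> o; rewrite in_cons => /orP [/eqP ->|/mapP [e + ->]].
    have [_ s0] := witness_e0 ne0.
    exact: polyfun_domain hv (hsl e0) vy1 s0.
  rewrite mem_filter => /andP [/witness_e [l li me] _].
  exists (witness (val e0).2 l); have [m0 s0] := witness_e0 li.
  by rewrite /F /cross /m m0 mul0r subr0 mulf_neq0.
have := hy None (mem_head _ _); rewrite /F mulf_eq0 negb_or => /andP [vy sy].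
have cy e : e != e0 -> cross e y != 0.
  move=> ee; apply: (hy (Some e)); rewrite in_cons /=; apply: map_f.
  by rewrite mem_filter ee mem_enum.
have [U hU] := polyfun_line y (push i0) hu; have [P hP] := polyfun_line y (push i0) hv.
pose A e : {poly K} := (m y e)%:P + 'X * (sl y e)%:P.
have AE e t : (A e).[t] = m (fun ik => y ik + t * push i0 ik) e.
  by rewrite /m msq_push !hornerE.
have eqP2 : P ^+ 2 * \prod_(e <- S) A e = U ^+ 2.
  apply/eqP; rewrite -subr_eq0; apply/eqP/horner_eq0 => t.
  rewrite hornerD hornerN hornerM !horner_exp horner_prod hU hP -H.
  under eq_bigr do rewrite AE.
  by rewrite subrr.
have P0 : P != 0.
  apply: contraNneq vy => P0; have := hP 0; rewrite P0 horner0 => ->.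
  by apply/eqP; congr v; apply: boolp.funext => ik; rewrite mul0r addr0.
pose t0 := - m y e0 / sl y e0.
have st : sl y e0 * t0 = - m y e0 by rewrite /t0 mulrC divfK.
have A0 : A e0 = (sl y e0)%:P * ('X - t0%:P).
  by rewrite mulrBr -polyCM st polyCN opprK /A; ring.
pose Q := \prod_(e <- rem e0 S) A e.
have Qt0 : ~~ root Q t0.
  rewrite rootE horner_prod prodf_seq_neq0; apply/allP => e.
  rewrite mem_rem_uniq // inE => /andP [/cy ce _] /=.
  rewrite !hornerE; apply: contraNneq ce => ce.
  rewrite /cross; apply/eqP; transitivity ((m y e + t0 * sl y e) * sl y e0).
    transitivity (m y e * sl y e0 + (sl y e0 * t0) * sl y e); last by ring.
    by rewrite st mulNr.
  by rewrite ce mul0r.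
have sN : ~~ root (sl y e0)%:P t0 by rewrite rootC.
have Q0 : Q != 0 by apply: contraNneq Qt0 => ->; rewrite root0.
have A00 : A e0 != 0 by rewrite A0 mulf_neq0 ?polyC_eq0 ?polyXsubC_eq0.
have mA0 : mup t0 (A e0) = 1%N.
  by rewrite A0 mupMr // -[_ - _]expr1 mup_XsubCX eqxx.
have prodE : \prod_(e <- S) A e = A e0 * Q by rewrite (big_rem e0).
rewrite prodE in eqP2.
have U0 : U != 0.
  apply: contraTneq (mulf_neq0 (expf_neq0 2 P0) (mulf_neq0 A00 Q0)) => U0.
  by rewrite eqP2 U0 expr0n eqxx.
have := congr1 (mup t0) eqP2; rewrite !expr2 !mupM ?mulf_neq0 // mA0 (mupNroot Qt0).
by move: (mup t0 P) (mup t0 U) => a b; lia.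
Qed.

End Nonsquare.

(** * The unsquared measurement variety *)

Section LengthVariety.
Variables (K : numClosedFieldType) (d n : nat).
Hypothesis dn : (d <= n)%N.
Local Notation edges := (pairs n.+1).
Local Notation M := (Mdn K d n.+1).
Local Notation L := (Ldn K d n.+1).

Lemma closed_Ldn : zariski_closed L.
Proof.
apply: (@closed_preim _ _ _ (@sqp K edges)) (closed_Mdn K n d) => e.
exact: polyfun_sqp.
Qed.

Lemma sqim_Ldn y : sqim L y <-> M y.
Proof.
split=> [[x Lx <-] //|My]; have [x xy] := sqp_surj y.
by exists x => //; rewrite /Ldn -[sq x]/(sqp x) xy.
Qed.

Lemma Ldn_main_component :
  exists Z, [/\ irreducible Z, subset Z L & forall y, M y <-> sqim Z y].
Proof.
apply: lift_irreducible; [exact: closed_Ldn|exact: irreducible_Mdn|].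
by move=> y /sqim_Ldn.
Qed.

Lemma Ldn_cover Z : (forall y, M y <-> sqim Z y) -> forall x, L x ->
  exists2 g, g \in enum {ffun edges -> bool} & Z (sgn g x).
Proof.
move=> ZM x Lx; have /ZM [z Zz zx] : M (sqp x) by [].
have [g zE] := sqp_fiber (esym zx); exists g; first by rewrite mem_enum.
by rewrite -zE.
Qed.

Lemma Ldn_sgn g x : L x -> L (sgn g x).
Proof. by rewrite /Ldn -[sq (sgn g x)]/(sqp (sgn g x)) sqp_sgn. Qed.

(** [Z] is covered by the finitely many sign translates of [Z0], so it lies in one of them, and
    maximality gives equality. *)
Lemma Ldn_component Z0 Z : irreducible Z0 -> subset Z0 L ->
  (forall y, M y <-> sqim Z0 y) -> irreducible_component L Z ->
  exists g, forall x, Z x <-> Z0 (sgn g x).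
Proof.
move=> irr0 Z0L Z0M [irrZ ZL maxZ]; have [c0 _ _] := irr0.
have [g||g Zg] := @irreducible_cover _ _ Z _ (enum {ffun edges -> bool})
  (fun g x => Z0 (sgn g x)) irrZ.
- by apply: closed_preim c0 => i; apply: polyfun_sgn.
- by move=> x /ZL; apply: Ldn_cover.
exists g => x; split; first exact: Zg.
apply: (maxZ (fun x => Z0 (sgn g x))) => //; first exact: irreducible_sgn.
by move=> z /Z0L /(Ldn_sgn g); rewrite sgnK.
Qed.

Lemma Ldn_pure_dim : variety_pure_dim L (d * n.+1 - 'C(d.+1, 2)).
Proof.
rewrite -(card_slots dn); split; first exact: closed_Ldn.
  have [_ [y /sqim_Ldn [x Lx _]] _] := irreducible_Mdn K d n.
  by exists x.
move=> Z compZ; have [irrZ ZL _] := compZ; have [Z0 [irr0 Z0L Z0M]] := Ldn_main_component.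
have [g ZE] := Ldn_component irr0 Z0L Z0M compZ.
have ZM y : M y <-> sqim Z y.
  split=> [/Z0M [x Zx xy]|[x /ZL Lx <-] //].
  by exists (sgn g x); [apply/ZE; rewrite sgnK|rewrite sqp_sgn].
split; last first.
  move=> [C [irrC CZ Clt]]; apply: (@Mdn_no_chain K d n dn).
  exists (fun i => sqim (C i)).
  have [|c1 c2 c3] := @sqim_irr_chain _ _ #|slots d n|.+1 C Z; first by split.
  by split=> // i ik y /(c2 i ik) /ZM.
have [W cW] := Mdn_chain K dn; have [_ /(_ _ (leqnn _)) WM _] := cW.
have [|C [[irrC CL Clt] _]] := lift_irr_chain cW closed_Ldn.
- by move=> y /WM /sqim_Ldn.
have [cZ _ _] := irrZ.
(* The lifted chain lies in [L] but perhaps not in [Z]. Its top lies in a sign translate of [Z], so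
   one sign change moves the whole chain into [Z]. *)
have [h||h Ch] := @irreducible_cover _ _ (C #|slots d n|) _ (enum {ffun edges -> bool})
  (fun h x => Z (sgn h x)) (irrC _ (leqnn _)).
- by apply: closed_preim cZ => i; apply: polyfun_sgn.
- by move=> x /(CL _ (leqnn _)); apply: Ldn_cover.
have Ctop i : (i <= #|slots d n|)%N -> subset (C i) (C #|slots d n|).
  move=> ik; suff H m : (i <= m)%N -> (m <= #|slots d n|)%N -> subset (C i) (C m) by apply: H.
  elim: m => [|m IH]; first by rewrite leqn0 => /eqP -> _ x.
  rewrite leq_eqVlt => /orP [/eqP -> _ x //|im mk].
  by have [sub _] := Clt m mk; move=> x /(IH im (ltnW mk)) /sub.
exists (fun i x => C i (sgn h x)); split=> i ik.
- exact/irreducible_sgn/irrC.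
- by move=> x /(Ctop i ik) /Ch; rewrite sgnK.
- have [sub [x [Cx nCx]]] := Clt i ik; split; first by move=> z /sub.
  by exists (sgn h x); rewrite sgnK.
Qed.

End LengthVariety.

Lemma irreducible_Ldn (K : numClosedFieldType) d n : irreducible (Ldn K d.+2 n.+1).
Proof.
have [Z0 [irr0 Z0L Z0M]] := Ldn_main_component K d.+2 n.
have [c0 _ _] := irr0.
suff LZ0 : subset (Ldn K d.+2 n.+1) Z0.
  by apply: eq_irreducible irr0 => x; split=> [/Z0L|/LZ0].
move=> x Lx; apply: boolp.contrapT => /(closed_cut c0) [F hF [F0]]; apply.
have [c hc FE] := polyfun_lincomb hF; rewrite FE.
have [z Zz zx] : sqim Z0 (sqp x) by apply/Z0M.
apply: lincomb_eq0 => s ss; have [h hh cE] := hc s ss.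
(* The coefficients depend only on the squares, and [x] has the same squares as the point [z] of
   [Z0]. *)
suff c0' : forall x, Z0 x -> c s x = 0.
  by rewrite cE -zx -[h _]/((fun x => h (sqp x)) z) -cE c0' ?mul0r.
have evenP f : evenfun f -> polyfun f.
  by move=> [k hk ->]; apply: polyfun_comp => // i; apply: polyfun_sqp.
apply: (@lincomb_indep K _ _ (fun e x => x e) Z0 (@polyfun K _) _ _ _
  (enum (pairs n.+1)) (@evenfun K _) c) => //.
- split; [exact: polyfun_cst|move=> f g; exact: polyfunB|move=> f g; exact: polyfunM].
- by move=> e; apply: polyfun_coord.
- by move=> f g hf hg; apply: irreducible_prime.
- exact: subring_evenfun.
- exact: evenP.
- by move=> e _; apply: evenfun_sqr.
(* Since [Z0] maps onto [M], squaring a relation on [Z0] gives an identity between squared lengths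
   of all configurations, to which [msq_nonsquare] applies. *)
- move=> s' ss' ts' _ _ [u hu ->] [v hv ->] Huv z' Zz'.
  have /Z0L [p pz] := Zz'.
  have [e0 e0S] : exists e0, e0 \in mask s' (enum (pairs n.+1)).
    have: (0 < size (mask s' (enum (pairs n.+1))))%N.
      by rewrite size_mask // -has_count; apply/hasP; exists true.
    by case: (mask _ _) => // e r _; exists e; rewrite mem_head.
  have := @msq_nonsquare K d n _ e0 (fun y => u (msq (cfg_of y)))
    (fun y => v (msq (cfg_of y))) (mask_uniq (enum_uniq _) s') e0S.
  move=> /(_ _ _ _ (fun ik => p ik.1 ik.2)); rewrite [cfg_of _](_ : _ = p) // pz.
  apply.
  + by apply: polyfun_comp hu => e; apply: polyfun_msq_cfg.
  + by apply: polyfun_comp hv => e; apply: polyfun_msq_cfg.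
  move=> y; have [w Zw wy] : sqim Z0 (msq (cfg_of y)) by apply/Z0M; exists (cfg_of y).
  have /eqP := Huv w Zw; rewrite subr_eq0 wy => /eqP <-; rewrite exprMn; congr (_ * _).
  by rewrite /bprod -prodrXl -wy.
- by move=> x' Zx'; rewrite -FE F0.
Qed.

Theorem theorem2p11 (R : realType) (d n : nat) :
  (1 <= d)%N -> (d + 2 <= n)%N ->
  variety_pure_dim (Ldn R[i] d n) (d * n - 'C(d.+1, 2)) /\
  ((2 <= d)%N -> irreducible (Ldn R[i] d n)).
Proof.
move=> _; case: n => [|n] dn; first by rewrite addn2 in dn.
split; first by apply: Ldn_pure_dim; lia.
by case: d dn => [|[|d]] // _ _; apply: irreducible_Ldn.
Qed.
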